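(* Let $E/\mathbb{Q}$ be an elliptic curve of Mordell--Weil rank $r$, $\mathcal{B}=(P_1,\dots,P_r)$ a basis of $M_E=E(\mathbb{Q})/E(\mathbb{Q})_{\mathrm{tors}}$, and $R_1,\dots,R_r>0$. Let $J_{\mathcal{B},R}:\mathcal{T}_E\to\mathbb{R}^{2r}$ be the toroidal embedding $$J_{\mathcal{B},R}(x_1,\dots,x_r)=(R_1\cos2\pi x_1,R_1\sin2\pi x_1,\dots,R_r\cos2\pi x_r,R_r\sin2\pi x_r),$$ where $(x_1,\dots,x_r)\in\mathbb{R}^r/\mathbb{Z}^r$ are the coordinates on $\mathcal{T}_E$ with respect to $\mathcal{B}$. If $P=n_1P_1+\cdots+n_rP_r$ with $n_i\in\mathbb{Z}$, then for $t\in[0,1]$ $$J_{\mathcal{B},R}(\gamma_P(t))=(R_1\cos2\pi n_1t,R_1\sin2\pi n_1t,\dots,R_r\cos2\pi n_rt,R_r\sin2\pi n_rt).$$ The winding vector $(n_1,\dots,n_r)$ is the coordinate vector of the homology class $P$. Under a change of Mordell--Weil basis, the winding vector transforms by $\mathrm{GL}_r(\mathbb{Z})$.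
   Context: For an elliptic curve $E/\mathbb{Q}$, $M_E:=E(\mathbb{Q})/E(\mathbb{Q})_{\mathrm{tors}}$ is free abelian of finite rank $r$; $V_E:=M_E\otimes_{\mathbb{Z}}\mathbb{R}$, equipped with the positive-definite canonical height pairing; the height torus is $\mathcal{T}_E:=V_E/M_E$ with the quotient flat metric. A basis $\mathcal{B}$ of $M_E$ identifies $V_E\cong\mathbb{R}^r$, $M_E\cong\mathbb{Z}^r$ and $\mathcal{T}_E\cong\mathbb{R}^r/\mathbb{Z}^r$. For $P\in M_E$, $\gamma_P:[0,1]\to\mathcal{T}_E$ is the closed geodesic $\gamma_P(t)=tP+M_E$; the map $P\mapsto[\gamma_P]$ identifies $M_E$ with $H_1(\mathcal{T}_E,\mathbb{Z})$. *)

(* Defs.v *)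
From HB Require Import structures.
From mathcomp Require Import all_boot all_order all_algebra.
From mathcomp Require Import all_classical all_reals all_analysis.
From mathcomp Require Import ring_quotient ring freeg.
Set Implicit Arguments.
Unset Strict Implicit.
Unset Printing Implicit Defensive.
Import Order.TTheory GRing.Theory Num.Theory.
Import numFieldNormedType.Exports.
Local Open Scope classical_set_scope.
Local Open Scope quotient_scope.
Local Open Scope ring_scope.

Section Weierstrass.
Variable F : fieldType.

(* y^2 + a1 x y + a3 y = x^3 + a2 x^2 + a4 x + a6 *)
Record weierstrass := Weierstrass { a1 : F; a2 : F; a3 : F; a4 : F; a6 : F }.

Definition discriminant (W : weierstrass) : F :=
  let b2 := a1 W ^+ 2 + 4 * a2 W in
  let b4 := 2 * a4 W + a1 W * a3 W in
  let b6 := a3 W ^+ 2 + 4 * a6 W in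
  let b8 := a1 W ^+ 2 * a6 W + 4 * a2 W * a6 W - a1 W * a3 W * a4 W
            + a2 W * a3 W ^+ 2 - a4 W ^+ 2 in
  - b2 ^+ 2 * b8 - 8 * b4 ^+ 3 - 27 * b6 ^+ 2 + 9 * b2 * b4 * b6.

Record ellipticCurve := EllipticCurve {
  weierstrass_of :> weierstrass;
  discriminant_neq0 : discriminant weierstrass_of != 0 }.

Variable E : ellipticCurve.

(* Projective points: None is the point at infinity. *)
Definition on_curve (p : option (F * F)) : bool :=
  if p is Some (x, y) then
    y ^+ 2 + a1 E * x * y + a3 E * y == x ^+ 3 + a2 E * x ^+ 2 + a4 E * x + a6 E
  else true.

Definition opp_pt (p : option (F * F)) : option (F * F) :=
  if p is Some (x, y) then Some (x, - y - a1 E * x - a3 E) else None.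

Definition add_pt (p q : option (F * F)) : option (F * F) :=
  match p, q with
  | None, _ => q
  | _, None => p
  | Some (x1, y1), Some (x2, y2) =>
    if p == opp_pt q then None else
    let l := if x1 == x2
             then (3 * x1 ^+ 2 + 2 * a2 E * x1 + a4 E - a1 E * y1)
                  / (2 * y1 + a1 E * x1 + a3 E)
             else (y1 - y2) / (x1 - x2) in
    let x3 := l ^+ 2 + a1 E * l - a2 E - x1 - x2 in
    opp_pt (Some (x3, y1 + l * (x3 - x1)))
  end.

(* The line y = s x + t meets the curve in the three affine points
   (x1, _), (x2, _), (x3, _), counted with multiplicity. *)
Definition line_meets (s t x1 x2 x3 : F) :=
  [/\ x1 + x2 + x3 = s ^+ 2 + a1 E * s - a2 E,
      x1 * x2 + x1 * x3 + x2 * x3 = a4 E - 2 * s * t - a1 E * t - a3 E * s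
    & x1 * x2 * x3 = t ^+ 2 + a3 E * t - a6 E].

Let eqsub (a b : F) : a - b = 0 -> a = b.
Proof. by move/eqP; rewrite subr_eq0 => /eqP. Qed.

Lemma opp_ptK : involutive opp_pt.
Proof. by case=> [[x y]|] //=; congr (Some (_, _)); ring. Qed.

Lemma on_curve_opp p : on_curve p -> on_curve (opp_pt p).
Proof.
case: p => [[x y]|] //= /eqP H; apply/eqP.
by rewrite -H; ring.
Qed.

Lemma line_meets_on s t x1 x2 x3 :
  line_meets s t x1 x2 x3 -> on_curve (Some (x3, s * x3 + t)).
Proof.
case=> h1 h2 h3; apply/eqP/eqsub.
have -> : a2 E = s ^+ 2 + a1 E * s - (x1 + x2 + x3) by rewrite h1; ring.
have -> : a4 E = x1 * x2 + x1 * x3 + x2 * x3 + 2 * s * t + a1 E * t + a3 E * s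
  by rewrite h2; ring.
have -> : a6 E = t ^+ 2 + a3 E * t - x1 * x2 * x3 by rewrite h3; ring.
ring.
Qed.

Lemma add_ptE x1 y1 x2 y2 : Some (x1, y1) <> opp_pt (Some (x2, y2)) ->
  on_curve (Some (x1, y1)) -> on_curve (Some (x2, y2)) ->
  exists s t x3, [/\ line_meets s t x1 x2 x3, y1 = s * x1 + t, y2 = s * x2 + t
    & add_pt (Some (x1, y1)) (Some (x2, y2)) = opp_pt (Some (x3, s * x3 + t))].
Proof.
move=> ne /eqP c1 /eqP c2; rewrite /add_pt; case: eqP => // _.
case: eqP => [e|/eqP d]; last first.
  have d0 : x1 - x2 != 0 by rewrite subr_eq0.
  set l := (y1 - y2) / (x1 - x2).
  have ly : l * (x1 - x2) = y1 - y2 by rewrite /l; field.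
  exists l, (y1 - l * x1), (l ^+ 2 + a1 E * l - a2 E - x1 - x2).
  have y2E : y2 = y1 - l * (x1 - x2) by rewrite ly; ring.
  split; [|ring|by rewrite y2E; ring|by congr opp_pt; congr (Some (_, _)); ring].
  move: c2; rewrite y2E => c2.
  have a6E : a6 E = y1 ^+ 2 + a1 E * x1 * y1 + a3 E * y1
                    - (x1 ^+ 3 + a2 E * x1 ^+ 2 + a4 E * x1) by rewrite c1; ring.
  have a4E : a4 E = (2 * l * y1 - l ^+ 2 * (x1 - x2) + a1 E * (y1 + l * x2)
       + a3 E * l - (x1 ^+ 2 + x1 * x2 + x2 ^+ 2) - a2 E * (x1 + x2)).
    apply: (mulIf d0); apply: eqsub; move/eqP: c2; rewrite -subr_eq0 => /eqP <-.
    by rewrite a6E; ring.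
  by split; rewrite ?a6E ?a4E; ring.
have yy : y1 = y2.
  have : (y1 - y2) * (y1 + y2 + a1 E * x1 + a3 E) = 0.
    move: c2; rewrite -e => c2.
    by apply: (etrans _ (subrr (a6 E + x1 ^+ 3 + a2 E * x1 ^+ 2 + a4 E * x1)));
     transitivity ((y1 ^+ 2 + a1 E * x1 * y1 + a3 E * y1)
                  - (y2 ^+ 2 + a1 E * x1 * y2 + a3 E * y2)); [ring|rewrite c1 c2; ring].
  move/eqP; rewrite mulf_eq0 => /orP[]; first by rewrite subr_eq0 => /eqP.
  move=> /eqP h; case: ne; rewrite /opp_pt e; congr (Some (_, _)).
  by apply: eqsub; rewrite -h e; ring.
subst x2 y2.
have d0 : 2 * y1 + a1 E * x1 + a3 E != 0.
  apply/eqP => h; apply: ne; rewrite /opp_pt; congr (Some (_, _)).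
  by apply: eqsub; rewrite -h; ring.
set l := (_ / _).
have ly : l * (2 * y1 + a1 E * x1 + a3 E)
   = 3 * x1 ^+ 2 + 2 * a2 E * x1 + a4 E - a1 E * y1 by rewrite /l; field.
exists l, (y1 - l * x1), (l ^+ 2 + a1 E * l - a2 E - x1 - x1).
split; [|ring|ring|by congr opp_pt; congr (Some (_, _)); ring].
have a6E : a6 E = y1 ^+ 2 + a1 E * x1 * y1 + a3 E * y1
                  - (x1 ^+ 3 + a2 E * x1 ^+ 2 + a4 E * x1) by rewrite c1; ring.
have a4E : a4 E = l * (2 * y1 + a1 E * x1 + a3 E)
  - (3 * x1 ^+ 2 + 2 * a2 E * x1 - a1 E * y1) by rewrite ly; ring.
by split; rewrite ?a6E ?a4E; ring.
Qed.

Lemma line_add s t x1 x2 x3 : line_meets s t x1 x2 x3 ->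
  Some (x1, s * x1 + t) <> opp_pt (Some (x2, s * x2 + t)) ->
  add_pt (Some (x1, s * x1 + t)) (Some (x2, s * x2 + t))
    = opp_pt (Some (x3, s * x3 + t)).
Proof.
case=> h1 h2 h3 ne; rewrite /add_pt; case: eqP => // _.
set l := (if _ then _ else _).
suff -> : l = s.
  have -> : s ^+ 2 + a1 E * s - a2 E - x1 - x2 = x3 by rewrite -h1; ring.
  by congr opp_pt; congr (Some (_, _)); ring.
rewrite /l; case: eqP => [e|/eqP d]; last first.
  have d0 : x1 - x2 != 0 by rewrite subr_eq0.
  by field.
subst x2.
have d0 : 2 * (s * x1 + t) + a1 E * x1 + a3 E != 0.
  apply/eqP => h; apply: ne; rewrite /opp_pt; congr (Some (_, _)).
  by apply: eqsub; rewrite -h; ring.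
apply: (mulIf d0); rewrite divfK //.
have -> : a2 E = s ^+ 2 + a1 E * s - (x1 + x1 + x3) by rewrite h1; ring.
have -> : a4 E = x1 * x1 + x1 * x3 + x1 * x3 + 2 * s * t + a1 E * t + a3 E * s
  by rewrite h2; ring.
by ring.
Qed.

Lemma line_meetsC s t x1 x2 x3 :
  line_meets s t x1 x2 x3 -> line_meets s t x2 x1 x3.
Proof. by case=> h1 h2 h3; split; rewrite -?h1 -?h2 -?h3; ring. Qed.

Lemma line_meetsR s t x1 x2 x3 :
  line_meets s t x1 x2 x3 -> line_meets s t x3 x2 x1.
Proof. by case=> h1 h2 h3; split; rewrite -?h1 -?h2 -?h3; ring. Qed.

Lemma line_meetsN s t x1 x2 x3 : line_meets s t x1 x2 x3 ->
  line_meets (- s - a1 E) (- t - a3 E) x1 x2 x3.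
Proof. by case=> h1 h2 h3; split; rewrite ?h1 ?h2 ?h3; ring. Qed.

(* Nonsingularity: a non-vertical line cannot meet the curve in Q and -Q. *)
Lemma line_not_opp s t x1 x2 : line_meets s t x1 x2 x2 ->
  2 * (s * x2 + t) + a1 E * x2 + a3 E = 0 -> False.
Proof.
case=> h1 h2 h3 h.
have E3 : a3 E = - 2 * (s * x2 + t) - a1 E * x2 by apply: eqsub; rewrite -h; ring.
have E2 : a2 E = s ^+ 2 + a1 E * s - (x1 + x2 + x2) by rewrite h1; ring.
have E4 : a4 E = x1 * x2 + x1 * x2 + x2 * x2 + 2 * s * t + a1 E * t + a3 E * s
  by rewrite h2; ring.
have E6 : a6 E = t ^+ 2 + a3 E * t - x1 * x2 * x2 by rewrite h3; ring.
have /eqP := discriminant_neq0 E; apply; rewrite /discriminant.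
by rewrite E6 E4 E3 E2; ring.
Qed.

Lemma opp_add_pt p : add_pt (opp_pt p) p = None.
Proof. by case: p => [[x y]|] //; rewrite /add_pt /opp_pt eqxx. Qed.

Lemma add_opp_pt p : add_pt p (opp_pt p) = None.
Proof. by rewrite -{1}[p]opp_ptK opp_add_pt. Qed.

Lemma add_pt0 p : add_pt p None = p.
Proof. by case: p => [[]|]. Qed.

Lemma add_ptC p q : on_curve p -> on_curve q -> add_pt p q = add_pt q p.
Proof.
case: p => [[x1 y1]|]; case: q => [[x2 y2]|] // c1 c2.
have [->|ne] := eqVneq (Some (x1, y1)) (opp_pt (Some (x2, y2))).
  by rewrite opp_add_pt add_opp_pt.
have [s [t [x3 [L e1 e2 ->]]]] := add_ptE (elimN eqP ne) c1 c2.
subst y1 y2; rewrite (line_add (line_meetsC L)) // => h.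
by case/eqP: ne; rewrite h opp_ptK.
Qed.

Lemma on_curve_add p q : on_curve p -> on_curve q -> on_curve (add_pt p q).
Proof.
case: p => [[x1 y1]|]; case: q => [[x2 y2]|] // c1 c2.
have [->|ne] := eqVneq (Some (x1, y1)) (opp_pt (Some (x2, y2))).
  by rewrite opp_add_pt.
have [s [t [x3 [L e1 e2 ->]]]] := add_ptE (elimN eqP ne) c1 c2.
exact/on_curve_opp/(line_meets_on L).
Qed.

Let opp_line s t x : opp_pt (Some (x, s * x + t))
  = Some (x, (- s - a1 E) * x + (- t - a3 E)).
Proof. by congr (Some (_, _)); ring. Qed.

Lemma opp_ptD p q : on_curve p -> on_curve q ->
  opp_pt (add_pt p q) = add_pt (opp_pt p) (opp_pt q).
Proof.
case: p => [[x1 y1]|]; case: q => [[x2 y2]|] // c1 c2.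
have [->|ne] := eqVneq (Some (x1, y1)) (opp_pt (Some (x2, y2))).
  by rewrite opp_ptK opp_add_pt add_opp_pt.
have [s [t [x3 [L e1 e2 ->]]]] := add_ptE (elimN eqP ne) c1 c2.
subst y1 y2; rewrite !(opp_line s t) (line_add (line_meetsN L)) // => h.
by case/eqP: ne; apply: (can_inj opp_ptK); rewrite (opp_line s t x1) h !opp_line.
Qed.

Lemma add_ptK p q : on_curve p -> on_curve q ->
  add_pt (add_pt p q) (opp_pt q) = p.
Proof.
case: p => [[x1 y1]|]; last by case: q => [[x2 y2]|] // _ c; rewrite add_opp_pt.
case: q => [[x2 y2]|] // c1 c2.
have [->|ne] := eqVneq (Some (x1, y1)) (opp_pt (Some (x2, y2))).
  by rewrite opp_add_pt.
have [s [t [x3 [L e1 e2 ->]]]] := add_ptE (elimN eqP ne) c1 c2.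
subst y1 y2; rewrite !opp_line.
have N := line_meetsN (line_meetsR L).
rewrite (line_add N) -?opp_line ?opp_ptK // => -[e h].
subst x3; apply: (line_not_opp L).
by move/(congr1 (fun z => s * x2 + t - z)): h; rewrite subrr => <-; ring.
Qed.

Lemma add_ptA_gen x1 y1 x2 y2 x3 y3 :
  let P := Some (x1, y1) in let Q := Some (x2, y2) in let T := Some (x3, y3) in
  on_curve P -> on_curve Q -> on_curve T ->
  P <> opp_pt Q -> Q <> opp_pt T -> add_pt P Q <> opp_pt T ->
  P <> opp_pt (add_pt Q T) -> add_pt P (add_pt Q T) = add_pt (add_pt P Q) T.
Proof.
move=> P Q T cP cQ cT nPQ nQT.
have [s1 [t1 [xd [L1 e1 e2 eD]]]] := add_ptE nPQ cP cQ.
have [s2 [t2 [xe [L2 e2' e3 eE]]]] := add_ptE nQT cQ cT.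
rewrite /P /Q /T eD eE opp_ptK => nDT nPE.
have [us|/eqP ns] := eqVneq s1 s2.
  have tt : t1 = t2 by apply: (addrI (s1 * x2)); rewrite -e2 us -e2'.
  subst s2 t2; case: (L1) (L2) => f1 f2 f3 [g1 g2 g3].
  have : (x3 - x1) * (x3 - xd) = 0.
    have s13 : xe = x1 + xd - x3.
      by apply: (addrI (x2 + x3)); rewrite g1 -f1; ring.
    transitivity ((x1 * x2 + x1 * xd + x2 * xd) - (x2 * x3 + x2 * xe + x3 * xe)).
      by rewrite s13; ring.
    by rewrite f2 g2 subrr.
  move/eqP; rewrite mulf_eq0 !subr_eq0 => /orP[/eqP e|/eqP e]; last first.
    by case: nDT; congr opp_pt; rewrite e3 e.
  have TP : Some (x3, y3) = P by rewrite e e3 e /P e1.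
  rewrite -eD -eE TP -/P -/Q [RHS]add_ptC ?on_curve_add //.
  by rewrite [add_pt Q P]add_ptC.
have u0 : s2 - s1 != 0 by rewrite subr_eq0 eq_sym; apply/eqP.
set u := s2 - s1 in u0.
pose w := (xd - xe) / u.
pose xS := w * (x3 - x1) / u + x2.
pose s3 := s2 + w; pose t3 := y3 - s3 * x3.
pose s4 := s1 + w; pose t4 := y1 - s4 * x1.
have s2E : s2 = s1 + u by rewrite /u; ring.
have t1E : t1 = y2 - s1 * x2 by rewrite e2; ring.
have t2E : t2 = y2 - s2 * x2 by rewrite e2'; ring.
case: L1 L2 => f1 f2 f3 [g1 g2 g3].
have E1 : a1 E = (x3 + xe - x1 - xd) / u - (s1 + s2).
  apply: (mulIf u0); rewrite mulrBl divfK //.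
  transitivity ((s2 ^+ 2 + a1 E * s2 - a2 E) - (s1 ^+ 2 + a1 E * s1 - a2 E)
       - (s1 + s2) * u); first by rewrite /u; ring.
  by rewrite -f1 -g1; ring.
have E2 : a2 E = s1 ^+ 2 + a1 E * s1 - (x1 + x2 + xd) by rewrite f1; ring.
have E3 : a3 E = ((x1 * x2 + x1 * xd + x2 * xd) - (x2 * x3 + x2 * xe + x3 * xe)
   + 2 * s1 * t1 - 2 * s2 * t2 + a1 E * (t1 - t2)) / u.
  by apply: (mulIf u0); rewrite divfK // f2 g2 /u; ring.
have E4 : a4 E = x1 * x2 + x1 * xd + x2 * xd + 2 * s1 * t1 + a1 E * t1
   + a3 E * s1 by rewrite f2; ring.
have E6 : a6 E = t1 ^+ 2 + a3 E * t1 - x1 * x2 * xd by rewrite f3; ring.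
have L3 : line_meets s3 t3 xd x3 xS.
  by split; rewrite ?E6 ?E4 ?E3 ?E2 ?E1 /t3 ?e3 /xS /s3 /w ?t2E ?t1E ?s2E; field.
have L4 : line_meets s4 t4 x1 xe xS.
  by split; rewrite ?E6 ?E4 ?E3 ?E2 ?E1 /t4 ?e1 /xS /s4 /w ?t2E ?t1E ?s2E; field.
have yD : opp_pt (Some (xd, s1 * xd + t1)) = Some (xd, s3 * xd + t3).
  congr (Some (_, _)).
  by rewrite E3 E1 /t3 e3 /s3 /w ?t2E ?t1E ?s2E; field.
have yE : opp_pt (Some (xe, s2 * xe + t2)) = Some (xe, s4 * xe + t4).
  congr (Some (_, _)).
  by rewrite E3 E1 /t4 e1 /s4 /w ?t2E ?t1E ?s2E; field.
have y3E : y3 = s3 * x3 + t3 by rewrite /t3; ring.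
have y1E : y1 = s4 * x1 + t4 by rewrite /t4; ring.
have nPE' : Some (x1, y1) <> opp_pt (Some (xe, s4 * xe + t4)).
  by rewrite -yE opp_ptK.
rewrite yD yE; move: nDT nPE'; rewrite yD y3E y1E => nDT nPE'.
rewrite (line_add L3) // (line_add L4) //; congr opp_pt; congr (Some (_, _)).
by rewrite /t3 /t4 e3 e1 /xS /s3 /s4 /w ?t2E ?t1E ?s2E; field.
Qed.

Lemma add_ptA p q r : on_curve p -> on_curve q -> on_curve r ->
  add_pt p (add_pt q r) = add_pt (add_pt p q) r.
Proof.
case: p => [[x1 y1]|] //; case: q => [[x2 y2]|]; last by rewrite add_pt0.
case: r => [[x3 y3]|]; last by rewrite !add_pt0.
set P := Some (x1, y1); set Q := Some (x2, y2); set T := Some (x3, y3).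
move=> cP cQ cT.
have oc := (on_curve_add, on_curve_opp).
have addKC X Y : on_curve X -> on_curve Y ->
    add_pt (opp_pt X) (add_pt X Y) = Y.
  by move=> cX cY; rewrite add_ptC ?oc // (add_ptC cX) // add_ptK.
have [e|/eqP nPQ] := eqVneq P (opp_pt Q); first by rewrite e opp_add_pt addKC.
have [e|/eqP nQT] := eqVneq Q (opp_pt T).
  by rewrite e opp_add_pt add_pt0 -{2}[T]opp_ptK add_ptK ?oc.
have [e|/eqP nDT] := eqVneq (add_pt P Q) (opp_pt T).
  rewrite e opp_add_pt -[T]opp_ptK -e opp_ptD // (add_ptC cQ) ?oc //.
  by rewrite -{2}[Q]opp_ptK add_ptK ?oc // add_opp_pt.
have [e|/eqP nPE] := eqVneq P (opp_pt (add_pt Q T)).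
  by rewrite {1 2}e opp_add_pt opp_ptD // (add_ptC (on_curve_opp cQ)) ?oc //
     -{2}[Q]opp_ptK add_ptK ?oc // opp_add_pt.
exact: add_ptA_gen.
Qed.

Definition rational_point := {p : option (F * F) | on_curve p}.
HB.instance Definition _ := Choice.on rational_point.

Definition point0 : rational_point := exist (fun p => on_curve p) None isT.
Definition point_opp (p : rational_point) : rational_point :=
  exist (fun p => on_curve p) _ (on_curve_opp (valP p)).
Definition point_add (p q : rational_point) : rational_point :=
  exist (fun p => on_curve p) _ (on_curve_add (valP p) (valP q)).

Fact point_addA : associative point_add.
Proof. by move=> p q r; apply: val_inj; rewrite /= add_ptA ?(valP p, valP q, valP r). Qed.

Fact point_addC : commutative point_add.
Proof. by move=> p q; apply: val_inj; rewrite /= add_ptC ?(valP p, valP q). Qed.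

Fact point_add0 : left_id point0 point_add.
Proof. by move=> p; apply: val_inj. Qed.

Fact point_addN : left_inverse point0 point_opp point_add.
Proof. by move=> p; apply: val_inj; rewrite /= opp_add_pt. Qed.

HB.instance Definition _ :=
  GRing.isZmodule.Build rational_point point_addA point_addC point_add0 point_addN.

End Weierstrass.

Section Torsion.
Variable M : zmodType.

Definition torsion : {pred M} :=
  [pred x | `[< exists2 n, (0 < n)%N & x *+ n = 0 >]].

Fact torsion_zmod_closed : zmod_closed torsion.
Proof.
split=> [|x y /asboolP[m m0 xm] /asboolP[n n0 yn]].
  by apply/asboolP; exists 1%N.
apply/asboolP; exists (m * n)%N; first by rewrite muln_gt0 m0.
by rewrite mulrnBl mulrnA xm mul0rn mulnC mulrnA yn mul0rn subrr.
Qed.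

HB.instance Definition _ := GRing.isZmodClosed.Build M torsion torsion_zmod_closed.

Definition Zbasis r (B : 'I_r -> M) : Prop :=
  (forall x, exists n : 'rV[int]_r, x = \sum_i B i *~ n 0 i) /\
  (forall n : 'rV[int]_r, \sum_i B i *~ n 0 i = 0 -> n = 0).

End Torsion.

(* The free part E(Q) / E(Q)_tors. *)
Definition mordell_weil (E : ellipticCurve rat) : zmodType :=
  Quotient.quot (@torsion (rational_point E)).

(* M (x)_Z R, presented as the free R-module on symbols <<x>> = x (x) 1, x in M,
   modulo the R-span of the elements <<x + y>> - <<x>> - <<y>>. *)
Section Tensor.
Variables (R : realType) (M : zmodType).

Definition additivity_relator (c : R) (x y : M) : {freeg M / R} :=
  << c *g x + y >> - << c *g x >> - << c *g y >>.

Definition additivity_rel : {pred {freeg M / R}} :=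
  [pred v | `[< exists s : seq (R * (M * M)),
    v = \sum_(z <- s) additivity_relator z.1 z.2.1 z.2.2 >]].

Lemma freegUZ (c d : R) (x : M) : c *: << d *g x >> = << (c * d) *g x >>.
Proof. by apply/eqP/freeg_eqP => y; rewrite coeffZ !coeffU mulrA. Qed.

Fact additivity_rel_submod : submod_closed additivity_rel.
Proof.
split=> [|c _ _ /asboolP[s ->] /asboolP[t ->]]; apply/asboolP.
  by exists [::]; rewrite big_nil.
exists ([seq (c * z.1, z.2) | z <- s] ++ t).
rewrite big_cat big_map scaler_sumr /=; congr (_ + _).
by apply: eq_bigr => z _; rewrite /additivity_relator !scalerBr !freegUZ.
Qed.

HB.instance Definition _ :=
  GRing.isSubmodClosed.Build R {freeg M / R} additivity_rel additivity_rel_submod.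

Definition tensorR := Quotient.quot additivity_rel.
HB.instance Definition _ := GRing.Zmodule.on tensorR.
HB.instance Definition _ := Quotient.on tensorR.

Definition tensor_scale (c : R) (v : tensorR) : tensorR := \pi_tensorR (c *: repr v).

Lemma tensor_scale_pi c (v : {freeg M / R}) :
  tensor_scale c (\pi_tensorR v) = \pi_tensorR (c *: v).
Proof.
apply/eqP; rewrite /tensor_scale -Quotient.idealrBE -scalerBr.
by apply: rpredZ; rewrite Quotient.idealrBE reprK.
Qed.

Let tensor_piD (u v : {freeg M / R}) : \pi_tensorR (u + v) = \pi_tensorR u + \pi_tensorR v.
Proof. exact: (Quotient.pi_add _ u v). Qed.

Fact tensor_scaleA c d v : tensor_scale c (tensor_scale d v) = tensor_scale (c * d) v.
Proof. by rewrite tensor_scale_pi scalerA. Qed.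

Fact tensor_scale1 : left_id 1 tensor_scale.
Proof. by move=> v; rewrite /tensor_scale scale1r reprK. Qed.

Fact tensor_scaleDr : right_distributive tensor_scale +%R.
Proof.
move=> c u v; rewrite -[u]reprK -[v]reprK -tensor_piD !tensor_scale_pi.
by rewrite scalerDr tensor_piD.
Qed.

Fact tensor_scaleDl v : {morph tensor_scale^~ v : c d / c + d}.
Proof. by move=> c d; rewrite /tensor_scale scalerDl tensor_piD. Qed.

HB.instance Definition _ := GRing.Zmodule_isLmodule.Build R tensorR
  tensor_scaleA tensor_scale1 tensor_scaleDr tensor_scaleDl.

Definition tensor_in (x : M) : tensorR := \pi_tensorR << x >>.

Lemma tensor_inD : {morph tensor_in : x y / x + y}.
Proof.
move=> x y; rewrite /tensor_in -tensor_piD; apply/eqP.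
rewrite -Quotient.idealrBE; apply/asboolP; exists [:: (1, (x, y))].
by rewrite big_seq1 /additivity_relator /= opprD addrA.
Qed.

Fact tensor_in_zmod_morphism : zmod_morphism tensor_in.
Proof. by move=> x y; apply: (addIr (tensor_in y)); rewrite -tensor_inD !subrK. Qed.

HB.instance Definition _ :=
  GRing.isZmodMorphism.Build M tensorR tensor_in tensor_in_zmod_morphism.

End Tensor.

(* The canonical topology of a finite-dimensional real vector space: a set is
   open iff its inverse image under every linear map R^n -> V is open.  It is
   the topology induced by any Euclidean norm on V, so in particular by the
   canonical height norm on E(Q)/tors (x) R. *)
Section FiniteTopology.
Variables (R : realType) (V : lmodType R).

Definition fin_open (U : set V) : Prop :=
  forall n (v : 'I_n -> V), open [set x : 'rV[R]_n | U (\sum_i x 0 i *: v i)].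

Fact fin_openT : fin_open setT.
Proof. by move=> n v; exact: openT. Qed.

Fact fin_openI (A B : set V) : fin_open A -> fin_open B -> fin_open (A `&` B).
Proof. by move=> oA oB n v; apply: openI; [exact: oA|exact: oB]. Qed.

Fact fin_open_bigU (I : Type) (f : I -> set V) :
  (forall i, fin_open (f i)) -> fin_open (\bigcup_i f i).
Proof.
by move=> of_ n v; exact: (@bigcup_open _ I setT _ (fun i _ => of_ i n v)).
Qed.

End FiniteTopology.

HB.instance Definition _ (R : realType) (M : zmodType) :=
  isOpenTopological.Build (tensorR R M)
    (@fin_openT R _) (@fin_openI R _) (@fin_open_bigU R _).

Section HeightTorus.
Variables (R : realType) (E : ellipticCurve rat).

Definition mw_space := tensorR R (mordell_weil E).
HB.instance Definition _ := GRing.Lmodule.on mw_space.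
HB.instance Definition _ := Topological.on mw_space.

Definition mw_lattice : {pred mw_space} :=
  [pred v | `[< exists P, v = tensor_in R P >]].

Fact mw_lattice_zmod_closed : zmod_closed mw_lattice.
Proof.
split=> [|_ _ /asboolP[P ->] /asboolP[Q ->]]; apply/asboolP.
  by exists 0; rewrite raddf0.
by exists (P - Q); rewrite raddfB.
Qed.

HB.instance Definition _ :=
  GRing.isZmodClosed.Build mw_space mw_lattice mw_lattice_zmod_closed.

Definition height_torus := quotient_topology (Quotient.quot mw_lattice).
HB.instance Definition _ := Topological.on height_torus.
HB.instance Definition _ := Quotient.on height_torus.
HB.instance Definition _ :=
  GRing.Zmodule.copy height_torus (Quotient.quot mw_lattice).

Definition geodesic (P : mordell_weil E) (t : R) : height_torus :=
  \pi_height_torus (t *: tensor_in R P).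

(* The point of the torus with coordinates x mod Z^r with respect to B. *)
Definition torus_point r (B : 'I_r -> mordell_weil E) (x : 'rV[R]_r) :
    height_torus :=
  \pi_height_torus (\sum_i x 0 i *: tensor_in R (B i)).

(* A representative in R^r of the coordinates of tau; it is only defined modulo
   Z^r, which is immaterial for [toroidal_embedding] below. *)
Definition torus_coord r (B : 'I_r -> mordell_weil E) (tau : height_torus) :
    'rV[R]_r :=
  xget 0 [set x | torus_point B x = tau].

Lemma half_ltn r (k : 'I_(2 * r)) : (k./2 < r)%N.
Proof. by rewrite ltn_half_double -mul2n. Qed.

(* (rho_0 cos 2 pi x_0, rho_0 sin 2 pi x_0, rho_1 cos 2 pi x_1, ...) *)
Definition circles r (rho : 'I_r -> R) (x : 'rV[R]_r) : 'rV[R]_(2 * r) :=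
  \row_k (let i := Ordinal (half_ltn k) in
          rho i * (if odd k then sin else cos) (2 * pi * x 0 i)).

Definition toroidal_embedding r (B : 'I_r -> mordell_weil E) (rho : 'I_r -> R)
    (tau : height_torus) : 'rV[R]_(2 * r) :=
  circles rho (torus_coord B tau).
End HeightTorus.

(* Singular homology in degree 1 with integer coefficients; [continuousType] is
   the library's type of continuous functions and the subset [simplex n] carries
   the subspace topology. *)
Section SingularHomology.
Variable R : realType.

Definition simplex n : set 'rV[R]_n.+1 :=
  [set x | (forall i, 0 <= x 0 i) /\ \sum_i x 0 i = 1].
Arguments simplex n : clear implicits.

(* The i-th face inserts a zero barycentric coordinate at position i. *)
Definition insert0 n (i : 'I_n.+2) (x : 'rV[R]_n.+1) : 'rV[R]_n.+2 :=
  \row_j (if unlift i j is Some k then x 0 k else 0).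

Fact insert0_simplex n (i : 'I_n.+2) (x : simplex n) :
  insert0 i (val x) \in simplex n.+1.
Proof.
case: x => x /= /set_mem[x0 x1]; apply/mem_set; split=> [j|].
  by rewrite mxE; case: unlift => [k|].
rewrite (bigD1_ord i) //= mxE unlift_none add0r -[RHS]x1.
by apply: eq_bigr => j _; rewrite mxE liftK.
Qed.

Definition face n (i : 'I_n.+2) (x : simplex n) : simplex n.+1 :=
  exist (fun y => y \in simplex n.+1) _ (insert0_simplex i x).

Lemma set_val_continuous n : continuous (fun x : simplex n => val x).
Proof. exact: initial_continuous. Qed.

Fact insert0_continuous n (i : 'I_n.+2) : continuous (@insert0 n i).
Proof.
move=> x U [P nP sPU].
have Fx : Filter (nbhs x) by exact: nbhs_filter.
suff : \forall y \near x, forall j, P 0 j (insert0 i y 0 j).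
  by apply: filterS => y Py; apply: sPU => i0 j; rewrite (ord1 i0); exact: Py.
apply: (filter_forall Fx) => j; have := nP 0 j; rewrite mxE.
case eij: (unlift i j) => [k|] nPj.
  have := @coord_continuous R 1 n.+1 0 k x _ nPj.
  by apply: (@filterS _ _ Fx) => y /=; rewrite mxE eij.
by apply: (@nearW _ _ _ Fx) => y; rewrite mxE eij; exact: (nbhs_singleton nPj).
Qed.

Fact face_continuous n (i : 'I_n.+2) : continuous (face i).
Proof.
apply: continuous_comp_initial => x.
apply: (@continuous_comp _ _ _ (fun x : simplex n => val x) (insert0 i)).
  exact: set_val_continuous.
exact: insert0_continuous.
Qed.

HB.instance Definition _ n (i : 'I_n.+2) :=
  @isContinuous.Build (simplex n) (simplex n.+1) (face i) (@face_continuous n i).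

Variable X : topologicalType.

Definition chain n := {freeg (continuousType (simplex n) X) / int}.
HB.instance Definition _ n := GRing.Zmodule.on (chain n).

Definition boundary n (c : chain n.+1) : chain n :=
  fglift (fun s : continuousType (simplex n.+1) X =>
    \sum_(i < n.+2)
      << (-1) ^+ i *g (s \o face i : continuousType (simplex n) X) >> : chain n) c.

Fact boundary_zmod_morphism n : zmod_morphism (@boundary n).
Proof. exact: lift_is_additive. Qed.

HB.instance Definition _ n :=
  GRing.isZmodMorphism.Build (chain n.+1) (chain n) (@boundary n)
    (@boundary_zmod_morphism n).

Definition is_cycle : {pred chain 1} := [pred c | boundary c == 0].

Fact is_cycle_zmod_closed : zmod_closed is_cycle.
Proof.
split=> [|c d /eqP c0 /eqP d0]; apply/eqP; first by rewrite raddf0.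
by rewrite raddfB /= c0 d0 subrr.
Qed.

HB.instance Definition _ :=
  GRing.isZmodClosed.Build (chain 1) is_cycle is_cycle_zmod_closed.

Definition cycle1 := {c : chain 1 | is_cycle c}.
HB.instance Definition _ := [isSub of cycle1 for val].
HB.instance Definition _ := [Choice of cycle1 by <:].
HB.instance Definition _ := [SubChoice_isSubZmodule of cycle1 by <:].

Definition is_boundary : {pred cycle1} :=
  [pred z | `[< exists d : chain 2, boundary d = val z >]].

Fact is_boundary_zmod_closed : zmod_closed is_boundary.
Proof.
split=> [|y z /asboolP[c cE] /asboolP[d dE]]; apply/asboolP.
  by exists 0; rewrite !raddf0.
by exists (c - d); rewrite boundary_zmod_morphism cE dE raddfB.
Qed.

HB.instance Definition _ :=
  GRing.isZmodClosed.Build cycle1 is_boundary is_boundary_zmod_closed.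

Definition H1 : zmodType := Quotient.quot is_boundary.

End SingularHomology.

Section GeodesicClass.
Variables (R : realType) (E : ellipticCurve rat) (P : mordell_weil E).

(* The closed geodesic of P, with Delta^1 parametrised by its second
   barycentric coordinate t. *)
Definition geodesic_simplex (x : @simplex R 1) : height_torus R E :=
  geodesic P (val x 0 1).

Fact geodesic_simplex_continuous : continuous geodesic_simplex.
Proof.
have c1 : continuous (fun t : R => t *: tensor_in R P).
  apply/continuousP => U oU.
  have := oU 1%N (fun=> tensor_in R P).
  have cc : continuous (fun t : R => const_mx t : 'rV[R]_1).
    move=> t A [Q nQ sQ]; have := nQ 0 0; rewrite mxE.
    apply: filterS => y Qy; apply: sQ => i j; rewrite !ord1 mxE; exact: Qy.
  move/continuousP: cc => /[apply]; congr open.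
  by apply/seteqP; split => t /=; rewrite big_ord1 mxE.
have c2 : continuous (\pi_(height_torus R E) : mw_space R E -> height_torus R E).
  exact: pi_continuous.
have c3 : continuous (geodesic P : R -> height_torus R E).
  move=> t; exact: (@continuous_comp _ _ _ (fun t : R => t *: tensor_in R P) _ _ (c1 t) (c2 _)).
move=> x; apply: (@continuous_comp _ _ _ (fun x : @simplex R 1 => val x 0 1) _ _ _ (c3 _)).
apply: (@continuous_comp _ _ _ (fun x : @simplex R 1 => val x) (fun M : 'rV[R]_2 => M 0 1)).
  exact: set_val_continuous.
exact: coord_continuous.
Qed.
HB.instance Definition _ := @isContinuous.Build _ _ geodesic_simplex
  geodesic_simplex_continuous.

Definition geodesic_chain : chain R (height_torus R E) 1 :=
  << (geodesic_simplex : continuousType (@simplex R 1) (height_torus R E)) >>.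

Lemma geodesic_loop : geodesic P 1 = geodesic P 0 :> height_torus R E.
Proof.
have /eqP : 1 *: tensor_in R P == 0 *: tensor_in R P
              %[mod Quotient.quot (@mw_lattice R E)].
  rewrite -Quotient.idealrBE scale1r scale0r subr0.
  by apply/asboolP; exists P.
exact: id.
Qed.

Fact geodesic_is_cycle : is_cycle geodesic_chain.
Proof.
rewrite /is_cycle inE /boundary liftU scale1r !big_ord_recl big_ord0 addr0 /=.
set s0 := (X in << _ *g X >> + _); set s1 := (X in _ + << _ *g X >>).
have -> : s1 = s0.
  apply/continuousEP => -[x xS] /=; rewrite /geodesic_simplex /= !mxE.
  have -> : (1 : 'I_2) = fintype.lift ord0 ord0 by apply: val_inj.
  rewrite unlift_none liftK -geodesic_loop; congr geodesic.
  by case/set_mem: xS => _; rewrite big_ord1 => ->.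
by rewrite freegUD expr0 expr1 subrr freegU0.
Qed.

Definition geodesic_class : H1 R (height_torus R E) :=
  \pi_(H1 R (height_torus R E)) (exist (fun c => is_cycle c) _ geodesic_is_cycle).
End GeodesicClass.

(* n is the vector of numbers of turns of the image of the closed curve c, given
   on [0, 1], around the r coordinate circles of the toroidal embedding. *)
Definition winding_vector (R : realType) (E : ellipticCurve rat) r
    (B : 'I_r -> mordell_weil E) (rho : 'I_r -> R)
    (c : R -> height_torus R E) (n : 'rV[int]_r) : Prop :=
  forall t, 0 <= t <= 1 ->
    toroidal_embedding B rho (c t) = circles rho (\row_i ((n 0 i)%:~R * t)).

(* Main.v *)
Require Import Defs.
From HB Require Import structures.
From mathcomp Require Import all_boot all_order all_algebra.
From mathcomp Require Import all_classical all_reals all_analysis.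
From mathcomp Require Import ring_quotient zify ring lra freeg.
Set Implicit Arguments.
Unset Strict Implicit.
Unset Printing Implicit Defensive.
Import Order.TTheory GRing.Theory Num.Theory.
Import numFieldNormedType.Exports.
Local Open Scope classical_set_scope.
Local Open Scope quotient_scope.
Local Open Scope ring_scope.

(** A basis of M = E(Q)/E(Q)_tors identifies M (x) R with R^r and M with Z^r, so
the height torus is R^r/Z^r ([torus_point_eq], [torus_point_surj]), the geodesic
of a point P with coordinate vector n is t |-> t n mod Z^r ([geodesicE]), and the
formulas for the toroidal embedding reduce to the periodicity of cos and sin.
Conversely, n is determined by the image curve: if n and n' differ in some
coordinate, then at a suitable time t in [0, 1] that coordinate of t (n - n') is
1/2 or -1/2, so t n and t n' differ modulo Z^r ([winding_unique]).

What has content is that the classes of the geodesics of the basis vectors form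
a basis of singular H_1. Both halves rest on lifting singular simplices through
R^r -> R^r/Z^r ([lift_exists]). The lift is given by a formula: along the segments from a fixed point of the simplex, uniform
continuity makes the angular increments of each circle coordinate small, so that
they are continuous arctangents, and a finite sum of them is a lift. Two lifts
differ by a continuous integer-valued function, hence by a constant
([lift_difference]).

Independence: sending a 1-simplex to the difference of the endpoints of a lift
defines a homomorphism from 1-chains to R^r that kills boundaries and maps the
geodesic of P to the coordinates of P ([total_displacement_boundary],
[total_displacement_geodesic]).

Generation: coning a lifted path g to the origin of R^r shows that its image is
homologous to spoke(g(0)) - spoke(g(1)), where spoke(a) is the image of the
segment from a to 0 ([cone_relation]). Applied to well-chosen paths, this one
relation gives spoke(a + m) ~ spoke(a) + spoke(m) for m in Z^r and
geodesic(P) ~ - spoke(n) for n the coordinates of P, so geodesic classes are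
additive in P; and it shows that every 1-simplex is homologous to a geodesic plus
a term that depends only on its boundary ([chain_class_span]). For a cycle that
term vanishes, so every class in H_1 is the class of a geodesic. *)

(** * Coordinates on the real Mordell-Weil space *)

Lemma freeg_gen_ind (R : nzRingType) (K : choiceType) (P : {freeg K / R} -> Prop) :
  P 0 -> (forall u v, P u -> P v -> P (u + v)) -> (forall c x, P << c *g x >>) ->
  forall D, P D.
Proof.
by move=> P0 PD PU D; rewrite -[D]freeg_sumE; apply: big_ind => // z _; apply: PU.
Qed.

Section FreeGroup.
Variables (R : nzRingType) (K : choiceType) (V : lmodType R) (f : K -> V).

HB.instance Definition _ :=
  GRing.isZmodMorphism.Build {freeg K / R} V (fglift f) (lift_is_additive f).

Lemma fglift_scale c D : fglift f (c *: D) = c *: fglift f D.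
Proof.
elim/freeg_gen_ind: D => [|u v IHu IHv|d x].
- by rewrite scaler0 raddf0 scaler0.
- by rewrite (scalerDr c u v) !raddfD /= IHu IHv -scalerDr.
- have -> : c *: << d *g x >> = << c * d *g x >> :> {freeg K / R}.
    by apply/eqP/freeg_eqP => y; rewrite coeffZ !coeffU mulrA.
  by rewrite !liftU scalerA.
Qed.
End FreeGroup.

Section ZBasis.
Variables (M : zmodType) (r : nat) (B : 'I_r -> M) (hB : Zbasis B).

Definition zcoord (x : M) : 'rV[int]_r := projT1 (cid (hB.1 x)).

Lemma zcoordE x : x = \sum_i B i *~ zcoord x 0 i.
Proof. by rewrite /zcoord; case: cid. Qed.

Lemma zcoord_unique x (n : 'rV[int]_r) : x = \sum_i B i *~ n 0 i -> zcoord x = n.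
Proof.
move=> xE; apply/subr0_eq/hB.2; rewrite -[RHS](subrr x).
rewrite [in X in _ = X - _](zcoordE x) [in X in _ = _ - X]xE.
by rewrite -sumrB; apply: eq_bigr => i _; rewrite !mxE mulrzBr.
Qed.

Lemma zcoord_zmod_morphism : zmod_morphism zcoord.
Proof.
move=> x y; apply: zcoord_unique; rewrite [in LHS](zcoordE x) [in LHS](zcoordE y) -sumrB.
by apply: eq_bigr => i _; rewrite !mxE mulrzBr.
Qed.

HB.instance Definition _ :=
  GRing.isZmodMorphism.Build M 'rV[int]_r zcoord zcoord_zmod_morphism.

Variable R : realType.

Definition int_row (n : 'rV[int]_r) : 'rV[R]_r := map_mx intr n.

Lemma int_row_zmod_morphism : zmod_morphism int_row.
Proof. by move=> m n; apply/rowP => i; rewrite !mxE rmorphB. Qed.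

HB.instance Definition _ := GRing.isZmodMorphism.Build _ _ int_row int_row_zmod_morphism.

(** The coordinate map on the free module that presents M (x) R; it factors through
the quotient because it kills the additivity relators. *)
Definition symbol_coord : {freeg M / R} -> 'rV[R]_r :=
  fglift (fun x => int_row (zcoord x)).

Lemma symbol_coord_rel u : u \in @additivity_rel R M -> symbol_coord u = 0.
Proof.
move=> /asboolP[s ->]; rewrite /symbol_coord raddf_sum big1 // => -[c [x y]] _ /=.
rewrite /additivity_relator !raddfB /= !liftU -!scalerBr.
by rewrite (raddfD zcoord) (raddfD int_row) [_ + int_row _]addrC addrK subrr scaler0.
Qed.

Definition tensor_coord (v : tensorR R M) : 'rV[R]_r := symbol_coord (repr v).

Lemma tensor_coord_pi u : tensor_coord (\pi_(tensorR R M) u) = symbol_coord u.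
Proof.
apply/subr0_eq; rewrite /tensor_coord /symbol_coord -raddfB; apply: symbol_coord_rel.
by rewrite Quotient.idealrBE reprK.
Qed.

Lemma tensor_piD (u v : {freeg M / R}) :
  \pi_(tensorR R M) (u + v) = \pi_(tensorR R M) u + \pi_(tensorR R M) v.
Proof. exact: (Quotient.pi_add _ u v). Qed.

Lemma tensor_piZ c (u : {freeg M / R}) :
  c *: \pi_(tensorR R M) u = \pi_(tensorR R M) (c *: u).
Proof. exact: tensor_scale_pi. Qed.

Lemma tensor_coordD : {morph tensor_coord : u v / u + v}.
Proof.
move=> u v; rewrite -[u]reprK -[v]reprK -tensor_piD !tensor_coord_pi.
exact: (raddfD (fglift _)).
Qed.

Lemma tensor_coord_zmod_morphism : zmod_morphism tensor_coord.
Proof. by move=> u v; apply: (addIr (tensor_coord v)); rewrite -tensor_coordD !subrK. Qed.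

HB.instance Definition _ :=
  GRing.isZmodMorphism.Build _ _ tensor_coord tensor_coord_zmod_morphism.

Lemma tensor_coordZ c v : tensor_coord (c *: v) = c *: tensor_coord v.
Proof.
rewrite -[v]reprK tensor_piZ !tensor_coord_pi.
exact: fglift_scale.
Qed.

HB.instance Definition _ := GRing.isScalable.Build _ _ _ _ tensor_coord tensor_coordZ.

Lemma tensor_coord_in x : tensor_coord (tensor_in R x) = int_row (zcoord x).
Proof. by rewrite tensor_coord_pi /symbol_coord liftU scale1r. Qed.

Definition tensor_comb (x : 'rV[R]_r) : tensorR R M :=
  \sum_i x 0 i *: tensor_in R (B i).

Lemma tensor_comb_linear : linear tensor_comb.
Proof.
move=> c x y; rewrite /tensor_comb scaler_sumr -big_split; apply: eq_bigr => i _ /=.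
by rewrite !mxE scalerDl scalerA.
Qed.

HB.instance Definition _ := GRing.isLinear.Build _ _ _ _ tensor_comb tensor_comb_linear.

Lemma zcoord_basis i : zcoord (B i) = delta_mx 0 i.
Proof.
apply: zcoord_unique; rewrite (bigD1 i) //= mxE !eqxx mulr1z big1 ?addr0 // => k ik.
by rewrite mxE (negbTE ik) andbF.
Qed.

(** The coordinate functionals come from the presentation of M (x) R, so they separate
the real combinations of the basis vectors; with [tensor_coordK], a Z-basis of M is
an R-basis of M (x) R. *)
Lemma tensor_combK : cancel tensor_comb tensor_coord.
Proof.
move=> x; apply/rowP => j; rewrite /tensor_comb raddf_sum summxE.
have E i : (tensor_coord (x 0 i *: tensor_in R (B i)) : 'rV[R]_r) 0 j = x 0 i * (j == i)%:R.
  by rewrite linearZ /= tensor_coord_in zcoord_basis !mxE eqxx /=; case: eqP.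
rewrite (bigD1 j) //= E eqxx mulr1 big1 ?addr0 // => i ij.
by rewrite E eq_sym (negbTE ij) mulr0.
Qed.

Lemma tensor_comb_int_row x : tensor_comb (int_row (zcoord x)) = tensor_in R x.
Proof.
rewrite {2}(zcoordE x) raddf_sum; apply: eq_bigr => i _.
by rewrite raddfMz mxE scaler_int.
Qed.

Lemma tensor_coordK : cancel tensor_coord tensor_comb.
Proof.
move=> v; rewrite -[v]reprK tensor_coord_pi.
elim/freeg_gen_ind: (repr v) => [|u w IHu IHw|c x].
- by rewrite /symbol_coord !raddf0.
- by rewrite /symbol_coord !raddfD /= -IHu -IHw.
- rewrite /symbol_coord liftU linearZ /= tensor_comb_int_row.
  by rewrite /tensor_in tensor_piZ freegUZ mulr1.
Qed.
End ZBasis.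

(** * Coordinates on the height torus *)

Section Turns.
Variable R : realType.
Implicit Types a b : R.

Lemma cos_sin_int (k : int) :
  cos (2 * pi * k%:~R) = 1 :> R /\ sin (2 * pi * k%:~R) = 0 :> R.
Proof.
have H (n : nat) : cos (2 * pi * n%:R) = 1 :> R /\ sin (2 * pi * n%:R) = 0 :> R.
  have -> : 2 * pi * n%:R = 0 + (pi *+ 2) *+ n :> R.
    by rewrite add0r -[pi *+ 2]mulr_natl mulr_natr.
  by rewrite (periodicn (@cosD2pi R)) (periodicn (@sinD2pi R)) cos0 sin0.
case: k => n; first exact: H.
by rewrite NegzE mulrNz mulrN cosN sinN -pmulrn (H n.+1).1 (H n.+1).2 oppr0.
Qed.

Lemma cos_turn a (k : int) : cos (2 * pi * (a + k%:~R)) = cos (2 * pi * a).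
Proof.
by rewrite mulrDr cosD (cos_sin_int k).1 (cos_sin_int k).2 mulr1 mulr0 subr0.
Qed.

Lemma sin_turn a (k : int) : sin (2 * pi * (a + k%:~R)) = sin (2 * pi * a).
Proof.
by rewrite mulrDr sinD (cos_sin_int k).1 (cos_sin_int k).2 mulr1 mulr0 addr0.
Qed.

(** With f the fractional part of a - b, cos(2 pi f) = 1 gives sin(pi f) = 0, which
forces f = 0 because sin is positive on ]0, pi[. *)
Lemma eq_turn a b : cos (2 * pi * a) = cos (2 * pi * b) ->
  sin (2 * pi * a) = sin (2 * pi * b) -> exists k : int, a = b + k%:~R.
Proof.
move=> eqc eqs; pose k := Num.floor (a - b); exists k.
pose f := a - b - k%:~R.
have f01 : 0 <= f < 1.
  by have := floor_itv (a - b); rewrite -/k /f; lra.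
have cf : cos (2 * pi * f) = 1.
  rewrite /f -mulrNz cos_turn mulrBr cosB eqc eqs -!expr2; exact: cos2Dsin2.
have sf : sin (pi * f) = 0.
  have : 2 * pi * f = (pi * f) *+ 2 by rewrite -[RHS]mulr_natl mulrA.
  move=> E; move: cf; rewrite E cos_mulr2n cos2sin2 => h.
  by apply/eqP; rewrite -sqrf_eq0; apply/eqP; lra.
suff f0 : f = 0 by move: f0; rewrite /f; lra.
apply/eqP/negPn/negP => fn0.
have f0 : 0 < f by rewrite lt0r fn0; case/andP: f01.
have : 0 < sin (pi * f).
  by rewrite sin_gt0_pi // mulr_gt0 ?pi_gt0 // gtr_pMr ?pi_gt0 //; case/andP: f01.
by rewrite sf ltxx.
Qed.
End Turns.

Section Continuity.
Variables (R : realType) (X : topologicalType).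

Lemma row_continuous n (f : X -> 'rV[R]_n) :
  (forall i, continuous (fun x => f x 0 i)) -> continuous f.
Proof.
move=> cf x U [P nP sPU].
have Fx : Filter (nbhs x) by exact: nbhs_filter.
suff : \forall y \near x, forall j, P 0 j (f y 0 j).
  by apply: filterS => y Py; apply: sPU => i j; rewrite (ord1 i); exact: Py.
by apply: (filter_forall Fx) => j; exact: cf (nP 0 j).
Qed.

Lemma continuous_sum (I : Type) (s : seq I) (f : I -> X -> R) :
  (forall i, continuous (f i)) -> continuous (fun x => \sum_(i <- s) f i x).
Proof.
by move=> cf; apply: continuous_big => [|i _]; [exact: add_continuous|exact: cf].
Qed.

Lemma continuous_add (f g : X -> R) :
  continuous f -> continuous g -> continuous (fun x => f x + g x).
Proof. by move=> cf cg x; apply: continuousD; [exact: cf|exact: cg]. Qed.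

Lemma continuous_sub (f g : X -> R) :
  continuous f -> continuous g -> continuous (fun x => f x - g x).
Proof. by move=> cf cg x; apply: continuousB; [exact: cf|exact: cg]. Qed.

Lemma continuous_mul (f g : X -> R) :
  continuous f -> continuous g -> continuous (fun x => f x * g x).
Proof. by move=> cf cg x; apply: continuousM; [exact: cf|exact: cg]. Qed.
End Continuity.

Section TorusCoordinates.
Variables (R : realType) (E : ellipticCurve rat) (r : nat).
Variables (B : 'I_r -> mordell_weil E) (hB : Zbasis B).

Local Notation T := (height_torus R E).
Local Notation p := (torus_point B : 'rV[R]_r -> T).

Lemma torus_point_eq (x y : 'rV[R]_r) :
  torus_point B x = torus_point B y :> T <-> exists m, x = y + int_row R m.
Proof.
rewrite /torus_point -![\sum_i _]/(tensor_comb _ _).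
have H u v : (\pi_T u = \pi_T v) <-> u - v \in @mw_lattice R E.
  rewrite Quotient.idealrBE; by split => [|/eqP //] h; apply/eqP.
rewrite H -raddfB; split=> [/asboolP[P]|[m ->]].
  rewrite -(tensor_comb_int_row hB) => /(can_inj (tensor_combK hB (R := R))) xy.
  by exists (zcoord hB P); rewrite -xy addrC subrK.
rewrite addrAC subrr add0r; apply/asboolP.
exists (\sum_i B i *~ m 0 i).
by rewrite -(tensor_comb_int_row hB) (zcoord_unique hB (erefl _)).
Qed.

Lemma torus_point_surj (tau : T) : exists x, torus_point B x = tau.
Proof.
exists (tensor_coord hB (repr tau)); rewrite /torus_point -[\sum_i _]/(tensor_comb _ _).
by rewrite tensor_coordK reprK.
Qed.

Lemma torus_coordK (tau : T) : torus_point B (torus_coord B tau) = tau.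
Proof.
rewrite /torus_coord; case: xgetP => [x _ //|noc].
by have [x xE] := torus_point_surj tau; case: (noc x).
Qed.

Lemma geodesicE P (t : R) :
  geodesic P t = torus_point B (t *: int_row R (zcoord hB P)).
Proof.
by rewrite /geodesic -(tensor_comb_int_row hB) -linearZ.
Qed.

(** The circle coordinates are independent of the chosen representative in R^r; they
are continuous and separate the points of the torus, and they are all that the
lifting argument uses of its topology. *)
Definition torus_cos i (tau : T) : R := cos (2 * pi * torus_coord B tau 0 i).
Definition torus_sin i (tau : T) : R := sin (2 * pi * torus_coord B tau 0 i).

Lemma torus_cosE i x : torus_cos i (torus_point B x) = cos (2 * pi * x 0 i).
Proof.
have /torus_point_eq[m xE] := torus_coordK (torus_point B x).
by rewrite /torus_cos xE !mxE cos_turn.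
Qed.

Lemma torus_sinE i x : torus_sin i (torus_point B x) = sin (2 * pi * x 0 i).
Proof.
have /torus_point_eq[m xE] := torus_coordK (torus_point B x).
by rewrite /torus_sin xE !mxE sin_turn.
Qed.

Lemma torus_cos_sin_inj (tau tau' : T) :
  (forall i, torus_cos i tau = torus_cos i tau') ->
  (forall i, torus_sin i tau = torus_sin i tau') -> tau = tau'.
Proof.
move=> ec es; rewrite -(torus_coordK tau) -(torus_coordK tau').
have H i := eq_turn (ec i) (es i).
apply/torus_point_eq; exists (\row_i projT1 (cid (H i))).
by apply/rowP => i; rewrite !mxE; case: cid.
Qed.

Lemma torus_point_continuous : continuous p.
Proof.
have c2 : continuous (\pi_T : mw_space R E -> T) by exact: pi_continuous.
have c1 : continuous (@tensor_comb _ _ B R : 'rV[R]_r -> mw_space R E).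
  by apply/continuousP => U oU; exact: (oU r (fun i => tensor_in R (B i))).
move=> x; exact: (@continuous_comp _ _ _ (@tensor_comb _ _ B R : 'rV[R]_r -> mw_space R E)
  (\pi_T : mw_space R E -> T) x (c1 x) (c2 _)).
Qed.

(** The topology of M (x) R is tested on all linear maps from R^n, and in coordinates
such a map is a linear map R^n -> R^r, which is continuous. *)
Lemma torus_continuous (h : T -> R) (k : 'rV[R]_r -> R) :
  (forall x, h (torus_point B x) = k x) -> continuous k -> continuous h.
Proof.
move=> hk ck; apply/quotient_continuous.
apply/continuousP => U oU.
suff : @fin_open R (mw_space R E) ((h \o \pi_T) @^-1` U) by [].
move=> n v; pose l (x : 'rV[R]_n) := \sum_i x 0 i *: tensor_coord hB (v i).
have cl : continuous l.
  apply: row_continuous => i.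
  have -> : (fun x => l x 0 i) =
      (fun x : 'rV[R]_n => \sum_j x 0 j * tensor_coord hB (v j) 0 i).
    by apply/funext => y; rewrite /l summxE; apply: eq_bigr => j _; rewrite mxE.
  apply: continuous_sum => j y.
  apply: (@continuousM R _ (fun x : 'rV[R]_n => x 0 j) (fun=> tensor_coord hB (v j) 0 i)).
    exact: coord_continuous.
  exact: cst_continuous.
have : continuous (k \o l).
  by move=> x; apply: continuous_comp; [exact: cl|exact: ck].
move=> /continuousP /(_ _ oU); congr open; apply/seteqP.
have lE (x : 'rV[R]_n) : h (\pi_T (\sum_i x 0 i *: v i)) = k (l x).
  rewrite -hk; congr h.
  suff -> : \sum_i x 0 i *: v i = tensor_comb B (l x) by [].
  rewrite -[LHS](tensor_coordK hB) raddf_sum; congr tensor_comb.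
  by apply: eq_bigr => i _; exact: linearZ.
by split => x /=; rewrite lE.
Qed.

Lemma torus_cos_continuous i : continuous (torus_cos i).
Proof.
apply: (torus_continuous (torus_cosE i)) => x.
apply: continuous_comp; last exact: continuous_cos.
apply: (@continuousM R _ (fun=> 2 * pi) (fun x : 'rV[R]_r => x 0 i)).
  exact: cst_continuous.
exact: coord_continuous.
Qed.

Lemma torus_sin_continuous i : continuous (torus_sin i).
Proof.
apply: (torus_continuous (torus_sinE i)) => x.
apply: continuous_comp; last exact: continuous_sin.
apply: (@continuousM R _ (fun=> 2 * pi) (fun x : 'rV[R]_r => x 0 i)).
  exact: cst_continuous.
exact: coord_continuous.
Qed.
End TorusCoordinates.

(** * Uniform continuity on simplices *)

Section Simplex.
Variables (R : realType) (n : nat).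
Local Notation S := (@simplex R n).

Lemma simplexP (x : S) : (forall i, 0 <= val x 0 i) /\ \sum_i val x 0 i = 1.
Proof. by case: x => x /= /set_mem. Qed.

Lemma simplex_le1 (x : S) i : 0 <= val x 0 i <= 1.
Proof.
have [x0 x1] := simplexP x; rewrite x0 /= -x1 (bigD1 i) //= lerDl.
by apply: sumr_ge0.
Qed.

Lemma simplex_coord_continuous i : continuous (fun x : S => val x 0 i).
Proof.
move=> x; apply: (@continuous_comp _ _ _ (fun x : S => val x) (fun x : 'rV[R]__ => x 0 i)).
  exact: set_val_continuous.
exact: coord_continuous.
Qed.

Lemma to_simplex_continuous (X : topologicalType) (f : X -> S) :
  (forall i, continuous (fun x => val (f x) 0 i)) -> continuous f.
Proof.
by move=> cf; apply: continuous_comp_initial; apply: row_continuous.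
Qed.

Lemma simplex_compact : compact S.
Proof.
apply: bounded_closed_compact.
  exists 1; split; first exact: num_real.
  move=> M M1 x xS; apply: le_trans (ltW M1).
  rewrite [leLHS]mx_normrE; apply/bigmax_leP; split=> // -[i j] _ /=.
  have := simplex_le1 (exist (fun y => y \in S) x (mem_set xS)) j.
  by rewrite /= (ord1 i) => /andP[x0 x1]; rewrite ger0_norm.
have -> : S = (\bigcap_i [set x : 'rV[R]_n.+1 | 0 <= x 0 i]) `&`
    [set x | \sum_i x 0 i = 1].
  apply/seteqP; split => x /= [x0 x1]; split => // i; first by move=> _; exact: x0.
  exact: x0.
apply: closedI.
  apply: closed_bigI => i _.
  apply: (@preimage_closed _ _ (fun x : 'rV[R]_n.+1 => x 0 i) [set y : R | 0 <= y]).
    by move=> x _; apply: coord_continuous.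
  exact: closed_ge.
apply: (@preimage_closed _ _ (fun x : 'rV[R]_n.+1 => \sum_i x 0 i) [set y : R | y = 1]).
  by move=> x _; move: x; apply: continuous_sum => i; exact: coord_continuous.
exact: closed_eq.
Qed.

(** Heine-Cantor for the simplex, proved by covering it with the neighbourhoods on
which f oscillates by less than e / 2. *)
Lemma simplex_unif_continuous (f : S -> R) (e : R) : continuous f -> 0 < e ->
  exists2 d, 0 < d & forall x y : S, `|val x - val y| < d -> `|f x - f y| < e.
Proof.
move=> cf e0.
have /compact_near_coveringP cov := simplex_compact.
pose near_f (d : R) z := forall x y : S, val x = z ->
  `|val x - val y| < d -> `|f x - f y| < e.
have : \forall d \near (0 : R)^'+, S `<=` near_f d.
  apply: cov => z zS; pose x0 : S := exist (fun y => y \in S) z (mem_set zS).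
  have e20 : 0 < e / 2 by rewrite divr_gt0.
  have /cvgrPdist_lt/(_ _ e20)/nbhs_ballP[d d0 dP] := cf x0.
  have {}dP x : `|z - val x| < d -> `|f x0 - f x| < e / 2.
    move=> zx; apply: (dP x).
    by rewrite -[ball x0 d x]/(ball z d (val x)) -ball_normE.
  have d20 : 0 < d / 2 by rewrite divr_gt0.
  near=> z' d'.
  have zz' : `|z - z'| < d / 2 by near: z'; exact: cvgr_dist_lt.
  have d'd : d' < d / 2 by near: d'; exact: nbhs_right_lt.
  move=> x y xz xy; have zx : `|z - val x| < d / 2 by rewrite xz.
  have fx : `|f x0 - f x| < e / 2 by apply: dP; apply: lt_trans zx _; lra.
  have fy : `|f x0 - f y| < e / 2.
    apply: dP; apply: le_lt_trans (ler_distD (val x) _ _) _.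
    by rewrite (splitr d) ltrD // (lt_trans xy).
  apply: le_lt_trans (ler_distD (f x0) _ _) _.
  by rewrite (splitr e) ltrD // distrC.
move=> covS; near (0 : R)^'+ => d.
have Sd : S `<=` near_f d by near: d.
by exists d => // x y; apply: (Sd (val x)) => //; exact: simplexP.
Unshelve. all: by end_near. Qed.
End Simplex.

(** * Lifting singular simplices to the universal cover *)

Lemma cos_sin_atan (R : realType) (c s : R) : 0 < c -> c ^+ 2 + s ^+ 2 = 1 ->
  cos (atan (s / c)) = c /\ sin (atan (s / c)) = s.
Proof.
move=> c0 cs; have cN0 : c != 0 by rewrite gt_eqF.
have ec : cos (atan (s / c)) = c.
  rewrite cos_atan; have -> : 1 + (s / c) ^+ 2 = (c^-1) ^+ 2.
    by transitivity ((c ^+ 2 + s ^+ 2) / c ^+ 2); [field | rewrite cs div1r exprVn].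
  by rewrite sqrtr_sqr ger0_norm ?invr_ge0 ?ltW // invrK.
split=> //; have := atanK (s / c); rewrite /tan ec => /(congr1 ( *%R^~ c)).
by rewrite !divfK.
Qed.

Section Homothety.
Variables (R : realType) (n : nat).
Local Notation S := (@simplex R n).
Implicit Types (x y : S) (s : R).

(** The default value x makes the operation total; it is only used for s in [0, 1]. *)
Definition homothety s x y : S := insubd x (val x + s *: (val y - val x)).

Lemma val_homothety s x y : 0 <= s <= 1 ->
  val (homothety s x y) = val x + s *: (val y - val x).
Proof.
move=> /andP[s0 s1]; rewrite val_insubd ifT //; apply/mem_set.
have [x0 x1] := simplexP x; have [y0 y1] := simplexP y.
have E i : (val x + s *: (val y - val x)) 0 i = (1 - s) * val x 0 i + s * val y 0 i.
  by rewrite !mxE; ring.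
split=> [i|].
  by rewrite E addr_ge0 // mulr_ge0 // subr_ge0.
under eq_bigr do rewrite E.
by rewrite big_split /= -!mulr_sumr x1 y1; ring.
Qed.

Lemma homothety0 x y : homothety 0 x y = x.
Proof. by apply: val_inj; rewrite val_homothety ?lexx ?ler01 // scale0r addr0. Qed.

Lemma homothety1 x y : homothety 1 x y = y.
Proof.
by apply: val_inj; rewrite val_homothety ?lexx ?ler01 // scale1r addrC subrK.
Qed.

Lemma homothety_continuous s x : 0 <= s <= 1 -> continuous (homothety s x).
Proof.
move=> s01; apply: to_simplex_continuous => i.
have -> : (fun y => val (homothety s x y) 0 i) =
    (fun y : S => val x 0 i + s * (val y 0 i - val x 0 i)).
  by apply/funext => y; rewrite val_homothety // !mxE.
apply: continuous_add; first exact: cst_continuous.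
apply: continuous_mul; first exact: cst_continuous.
by apply: continuous_sub; [exact: simplex_coord_continuous|exact: cst_continuous].
Qed.

Lemma dist_homothety s t x y : 0 <= s <= 1 -> 0 <= t <= 1 ->
  `|val (homothety s x y) - val (homothety t x y)| <= `|s - t|.
Proof.
move=> s01 t01; rewrite !val_homothety //.
have -> : val x + s *: (val y - val x) - (val x + t *: (val y - val x)) =
   (s - t) *: (val y - val x).
  by apply/rowP => i; rewrite !mxE; ring.
rewrite normrZ ler_piMr //.
rewrite [leLHS]mx_normrE; apply/bigmax_leP; split=> // -[i j] _ /=.
have := simplex_le1 x j; have := simplex_le1 y j; rewrite (ord1 i) !mxE ler_norml.
by move=> /andP[y0 y1] /andP[x0 x1]; apply/andP; split; lra.
Qed.

Lemma subdivision_in01 (N k : nat) : (k <= N)%N -> (0 < N)%N ->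
  0 <= (k%:R / N%:R : R) <= 1.
Proof.
by move=> kN N0; rewrite divr_ge0 //= ler_pdivrMr ?ltr0n // mul1r ler_nat.
Qed.

Lemma fine_subdivision (d : R) : 0 < d -> exists2 N : nat, (0 < N)%N &
  forall k x y, (k < N)%N ->
    `|val (homothety (k%:R / N%:R) x y) - val (homothety (k.+1%:R / N%:R) x y)| < d.
Proof.
move=> d0; pose N := (Num.truncn d^-1).+1; exists N => // k x y kN.
have Nd : N%:R^-1 < d by rewrite invf_plt ?posrE ?ltr0n // truncnS_gt.
apply: le_lt_trans Nd; apply: le_trans (dist_homothety _ _ _ _) _.
- by rewrite subdivision_in01 // ltnW.
- by rewrite subdivision_in01.
have -> : k%:R / N%:R - k.+1%:R / N%:R = - N%:R^-1 :> R by rewrite -natr1; ring.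
by rewrite normrN ger0_norm // invr_ge0 ler0n.
Qed.

(** By uniform continuity the values at consecutive points of a fine subdivision of the
segment [x, y] are integers at distance less than 1, hence equal. *)
Lemma integer_valued_constant (h : S -> R) : continuous h ->
  (forall x, exists m : int, h x = m%:~R) -> forall x y, h x = h y.
Proof.
move=> ch hZ x y; have [d d0 hc] := simplex_unif_continuous ch ltr01.
have [N N0 Nd] := fine_subdivision d0.
have H k : (k <= N)%N -> h (homothety (k%:R / N%:R) x y) = h x.
  elim: k => [_|k IH kN]; first by rewrite mul0r homothety0.
  rewrite -(IH (ltnW kN)); have := hc _ _ (Nd k x y kN).
  have [m ->] := hZ (homothety (k%:R / N%:R) x y).
  have [m' ->] := hZ (homothety (k.+1%:R / N%:R) x y).
  by rewrite -intrB -intr_norm ltrz1 -?ltz0_ge1 => h1; congr (_%:~R); lia.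
by have := H N (leqnn N); rewrite divff ?homothety1 // pnatr_eq0 -lt0n.
Qed.

(** A continuous unit vector (u, v) on a simplex has a continuous angle. Subdivide the
segments issued from x0 so finely that consecutive unit vectors are less than a
quarter turn apart: the angle between them is then the arctangent of a continuous
function, and the angle at x is the sum of these increments along [x0, x]. *)
Lemma angle_lift (u v : S -> R) : continuous u -> continuous v ->
  (forall x, u x ^+ 2 + v x ^+ 2 = 1) -> S ->
  (forall x, exists a, cos (2 * pi * a) = u x /\ sin (2 * pi * a) = v x) ->
  exists2 g : S -> R, continuous g &
    forall x, cos (2 * pi * g x) = u x /\ sin (2 * pi * g x) = v x.
Proof.
move=> cu cv uv x0 angle.
have [du du0 uc] := simplex_unif_continuous cu ltr01.
have [dv dv0 vc] := simplex_unif_continuous cv ltr01.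
have [N N0 Nd] : exists2 N : nat, (0 < N)%N & forall k x y, (k < N)%N ->
    `|val (homothety (k%:R / N%:R) x y) - val (homothety (k.+1%:R / N%:R) x y)|
      < Num.min du dv.
  by apply: fine_subdivision; rewrite lt_min du0.
pose z (k : nat) x := homothety (k%:R / N%:R) x0 x.
(* Cosine and sine of the angle between the unit vectors at z k x and z k.+1 x. *)
pose c k x := u (z k x) * u (z k.+1 x) + v (z k x) * v (z k.+1 x).
pose s k x := v (z k.+1 x) * u (z k x) - u (z k.+1 x) * v (z k x).
pose th k x : R := atan (s k x / c k x) / (2 * pi).
(* |U - U'|^2 = 2 - 2 <U, U'> for unit vectors U, U', so coordinates that differ by
   less than 1 force <U, U'> > 0. *)
have c0 k x : (k < N)%N -> 0 < c k x.
  move=> kN; have := Nd k x0 x kN; rewrite lt_min => /andP[/uc + /vc].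
  rewrite -/(z k x) -/(z k.+1 x).
  have := uv (z k x); have := uv (z k.+1 x); rewrite /c.
  move: (u (z k x)) (v (z k x)) (u (z k.+1 x)) (v (z k.+1 x)) => u1 v1 u2 v2.
  move=> h2 h1 hu hv.
  have : (v1 - v2) ^+ 2 < 1 by rewrite -real_normK ?num_real // expr_lt1.
  have : (u1 - u2) ^+ 2 < 1 by rewrite -real_normK ?num_real // expr_lt1.
  by nra.
have cs k x : c k x ^+ 2 + s k x ^+ 2 = 1.
  transitivity ((u (z k x) ^+ 2 + v (z k x) ^+ 2) *
                (u (z k.+1 x) ^+ 2 + v (z k.+1 x) ^+ 2)).
    by rewrite /c /s; ring.
  by rewrite !uv mulr1.
have thE k x : (k < N)%N ->
    cos (2 * pi * th k x) = c k x /\ sin (2 * pi * th k x) = s k x.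
  move=> kN; have -> : 2 * pi * th k x = atan (s k x / c k x).
    by rewrite /th mulrCA divff ?mulr1 // mulf_neq0 ?pnatr_eq0 // gt_eqF ?pi_gt0.
  exact: cos_sin_atan (c0 k x kN) (cs k x).
have [a [ca sa]] := angle x0.
pose g m x := a + \sum_(k < m) th k x.
have gE m x : (m <= N)%N ->
    cos (2 * pi * g m x) = u (z m x) /\ sin (2 * pi * g m x) = v (z m x).
  elim: m => [_|m IH mN].
    by rewrite /g big_ord0 addr0 /z mul0r homothety0.
  have [gc gs] := IH (ltnW mN); have [tc ts] := thE m x mN.
  have -> : 2 * pi * g m.+1 x = 2 * pi * g m x + 2 * pi * th m x.
    by rewrite /g big_ord_recr /= addrA mulrDr.
  rewrite cosD sinD gc gs tc ts /c /s; have := uv (z m x).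
  move: (u (z m x)) (v (z m x)) (u (z m.+1 x)) (v (z m.+1 x)) => u1 v1 u2 v2 h.
  by split; rewrite -[RHS]mul1r -h; ring.
exists (g N) => [|x]; last first.
  by have := gE N x (leqnn N); rewrite /z divff ?homothety1 // pnatr_eq0 -lt0n.
have cz k : (k <= N)%N -> continuous (z k).
  by move=> kN; apply: homothety_continuous; rewrite subdivision_in01.
have cuz k : (k <= N)%N -> continuous (u \o z k).
  by move=> kN x; apply: continuous_comp; [exact: cz|exact: cu].
have cvz k : (k <= N)%N -> continuous (v \o z k).
  by move=> kN x; apply: continuous_comp; [exact: cz|exact: cv].
apply: continuous_add; first exact: cst_continuous.
apply: continuous_sum => k; apply: continuous_mul; last exact: cst_continuous.
have kN := ltn_ord k; have kN' := ltnW kN => x.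
apply: (@continuous_comp _ _ _ (fun x => s k x / c k x) atan);
  last exact: continuous_atan.
apply: continuousM.
  by apply: continuous_sub; apply: continuous_mul;
    [exact: cvz|exact: cuz|exact: cuz|exact: cvz].
apply: continuousV; first by rewrite gt_eqF ?c0.
by apply: continuous_add; apply: continuous_mul;
  [exact: cuz|exact: cuz|exact: cvz|exact: cvz].
Qed.
End Homothety.

Section Vertices.
Variable R : realType.

Fact vertex_subproof n (i : 'I_n.+1) : (delta_mx 0 i : 'rV[R]_n.+1) \in @simplex R n.
Proof.
apply/mem_set; split=> [j|]; first by rewrite mxE eqxx ler0n.
rewrite (bigD1 i) //= mxE !eqxx big1 ?addr0 // => j ji.
by rewrite mxE (negbTE ji) andbF.
Qed.

Definition vertex n (i : 'I_n.+1) : @simplex R n :=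
  exist (fun y => y \in @simplex R n) _ (vertex_subproof i).

Lemma simplex1_sum (y : @simplex R 1) : val y 0 0 + val y 0 1 = 1.
Proof.
have [_] := simplexP y; rewrite !big_ord_recl big_ord0 addr0 => <-.
by congr (_ + val y 0 _); apply: val_inj.
Qed.

Lemma simplex1_inj (x y : @simplex R 1) : val x 0 0 = val y 0 0 -> x = y.
Proof.
move=> xy0; have := simplex1_sum x; rewrite xy0 -(simplex1_sum y).
move=> /addrI xy1; apply/val_inj/rowP => i.
by have [->|->] : i = 0 \/ i = 1 by case: i => [[|[]]] // ?; [left|right]; apply: val_inj.
Qed.

(** The parameter is the barycentric coordinate at vertex 0, so that t = 0 is vertex 1. *)
Definition edge_point (t : R) : @simplex R 1 := homothety t (vertex 1) (vertex 0).

Lemma edge_point0E t : 0 <= t <= 1 -> val (edge_point t) 0 0 = t.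
Proof. by move=> t01; rewrite val_homothety // !mxE /=; ring. Qed.

Lemma edge_pointK (y : @simplex R 1) : edge_point (val y 0 0) = y.
Proof. by apply: simplex1_inj; rewrite edge_point0E // simplex_le1. Qed.

Lemma edge_point0 : edge_point 0 = vertex 1. Proof. exact: homothety0. Qed.
Lemma edge_point1 : edge_point 1 = vertex 0. Proof. exact: homothety1. Qed.

Lemma edge_point_continuous (X : topologicalType) (f : X -> R) :
  (forall x, 0 <= f x <= 1) -> continuous f -> continuous (fun x => edge_point (f x)).
Proof.
move=> f01 cf; apply: to_simplex_continuous => i.
have -> : (fun x => val (edge_point (f x)) 0 i) =
    (fun x => val (vertex 1) 0 i + f x * (val (vertex 0) 0 i - val (vertex 1) 0 i)).
  by apply/funext => y; rewrite val_homothety // !mxE.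
apply: continuous_add; first exact: cst_continuous.
by apply: continuous_mul => //; exact: cst_continuous.
Qed.

Lemma face_lift n i (y : @simplex R n) k : val (face i y) 0 (fintype.lift i k) = val y 0 k.
Proof. by rewrite /= mxE liftK. Qed.

Lemma face_self n i (y : @simplex R n) : val (face i y) 0 i = 0.
Proof. by rewrite /= mxE unlift_none. Qed.

Lemma face_vertex n (i : 'I_n.+2) (j : 'I_n.+1) :
  face i (vertex j) = vertex (fintype.lift i j) :> @simplex R n.+1.
Proof.
apply/val_inj/rowP => k; rewrite /= !mxE.
case: unliftP => [k' ->|->]; first by rewrite mxE (inj_eq lift_inj).
by rewrite (negbTE (neq_lift i j)) andbF.
Qed.

Section TriangleFaces.
Variable y : @simplex R 1.

Let lift0E (i : 'I_3) (k : 'I_2) j : fintype.lift i k = j -> val (face i y) 0 j = val y 0 k.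
Proof. by move=> <-; exact: face_lift. Qed.

Lemma face0_triangle : [/\ val (face 0 y) 0 0 = 0 & val (face 0 y) 0 2 = val y 0 1].
Proof. by split; [exact: face_self | apply: lift0E; apply: val_inj]. Qed.

Lemma face1_triangle : [/\ val (face 1 y) 0 0 = val y 0 0 & val (face 1 y) 0 2 = val y 0 1].
Proof. by split; apply: lift0E; apply: val_inj. Qed.

Lemma face2_triangle : [/\ val (face 2 y) 0 0 = val y 0 0 & val (face 2 y) 0 2 = 0].
Proof. by split; [apply: lift0E; apply: val_inj | exact: face_self]. Qed.
End TriangleFaces.
End Vertices.

Section Lifts.
Variables (R : realType) (E : ellipticCurve rat) (r : nat).
Variables (B : 'I_r -> mordell_weil E) (hB : Zbasis B).
Local Notation T := (height_torus R E).

Definition is_lift n (s : @simplex R n -> T) (g : @simplex R n -> 'rV[R]_r) :=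
  continuous g /\ forall x, torus_point B (g x) = s x.

(** Lift each circle coordinate separately; the lifts assemble because the circle
coordinates separate the points of the torus. *)
Lemma lift_exists n (s : @simplex R n -> T) : continuous s -> exists g, is_lift s g.
Proof.
move=> cs.
have H i : exists2 g : @simplex R n -> R, continuous g & forall x,
    cos (2 * pi * g x) = torus_cos B i (s x) /\
    sin (2 * pi * g x) = torus_sin B i (s x).
  apply: angle_lift (vertex R 0) _ => [||x|x].
  - by move=> x; apply: continuous_comp; [exact: cs|exact: torus_cos_continuous].
  - by move=> x; apply: continuous_comp; [exact: cs|exact: torus_sin_continuous].
  - by rewrite cos2Dsin2.
  - by exists (torus_coord B (s x) 0 i).
pose g i := projT1 (cid2 (H i)).
have gc i : continuous (g i) by rewrite /g; case: cid2.
have gE i x : cos (2 * pi * g i x) = torus_cos B i (s x) /\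
              sin (2 * pi * g i x) = torus_sin B i (s x).
  by rewrite /g; case: cid2.
exists (fun x => \row_i g i x); split=> [|x].
  apply: row_continuous => i.
  by have -> : (fun x => (\row_i g i x) 0 i) = g i by apply/funext => x; rewrite mxE.
apply: (torus_cos_sin_inj hB) => i.
  by rewrite torus_cosE // mxE (gE i x).1.
by rewrite torus_sinE // mxE (gE i x).2.
Qed.

(** Each coordinate of the difference of two lifts is continuous and integer-valued. *)
Lemma lift_difference n (s : @simplex R n -> T) g g' : is_lift s g -> is_lift s g' ->
  forall x y, g x - g y = g' x - g' y.
Proof.
move=> [cg gs] [cg' gs'] x y; apply/rowP => i; rewrite !mxE.
have : g x 0 i - g' x 0 i = g y 0 i - g' y 0 i; last by move=> h; lra.
have ci (f : @simplex R n -> 'rV[R]_r) : continuous f -> continuous (fun x => f x 0 i).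
  move=> cf z; apply: (@continuous_comp _ _ _ f (fun y : 'rV[R]_r => y 0 i)).
    exact: cf.
  exact: coord_continuous.
apply: (@integer_valued_constant _ _ (fun x => g x 0 i - g' x 0 i)).
  by apply: continuous_sub; exact: ci.
move=> z; have /(torus_point_eq hB)[m ->] : torus_point B (g z) = torus_point B (g' z) :> T.
  by rewrite gs gs'.
by exists (m 0 i); rewrite !mxE addrAC subrr add0r.
Qed.
End Lifts.

(** * Chains modulo boundaries *)

Section Chains.
Variables (R : realType) (X : topologicalType).
Local Notation sing n := (continuousType (@simplex R n) X).

Lemma chain_ind n (P : chain R X n -> Prop) :
  P 0 -> (forall u v, P u -> P v -> P (u - v)) -> (forall s : sing n, P << s >>) ->
  forall c, P c.
Proof.
move=> P0 PB PU; have PN u : P u -> P (- u) by rewrite -sub0r; apply: PB.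
have PD u v : P u -> P v -> P (u + v) by move=> ? /PN ?; rewrite -(opprK v); apply: PB.
apply: freeg_gen_ind => // k s.
have Pn (n' : nat) : P (<< s >> *+ n').
  by elim: n' => [|n' IH]; rewrite ?mulr0n // mulrS; apply: PD.
have -> : << k *g s >> = << s >> *~ k :> chain R X n.
  by rewrite freegU_mulz intz.
by case: k => m; [exact: Pn|rewrite NegzE mulrNz; apply/PN/Pn].
Qed.

Lemma boundary_edge (s : sing 1) : boundary (<< s >> : chain R X 1) =
  << (s \o face 0 : sing 0) >> - << (s \o face 1 : sing 0) >>.
Proof.
rewrite /boundary liftU scale1r !big_ord_recl big_ord0 addr0 expr0 expr1 -freegUN.
by congr (_ - << (s \o face _ : sing 0) >>); apply: val_inj.
Qed.

Lemma boundary_triangle (s : sing 2) : boundary (<< s >> : chain R X 2) =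
  << (s \o face 0 : sing 1) >> - << (s \o face 1 : sing 1) >>
  + << (s \o face 2 : sing 1) >>.
Proof.
rewrite /boundary liftU scale1r !big_ord_recl big_ord0 addr0 expr0 expr1 -freegUN.
rewrite expr2 mulrNN mulr1 addrA.
by congr (_ - << (s \o face _ : sing 1) >> + << (s \o face _ : sing 1) >>);
  apply: val_inj.
Qed.

Definition bounding : {pred chain R X 1} :=
  [pred c | `[< exists d : chain R X 2, boundary d = c >]].

Fact bounding_zmod_closed : zmod_closed bounding.
Proof.
split=> [|_ _ /asboolP[c <-] /asboolP[d <-]]; apply/asboolP.
  by exists 0; rewrite raddf0.
by exists (c - d); rewrite raddfB.
Qed.

HB.instance Definition _ := GRing.isZmodClosed.Build _ bounding bounding_zmod_closed.

(** The quotient of all 1-chains, not only of the cycles, by the boundaries: homologies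
between paths with free endpoints become equations in an abelian group. *)
Definition chain_class (c : chain R X 1) : Quotient.quot bounding :=
  \pi_(Quotient.quot bounding) c.

Lemma chain_class_zmod_morphism : zmod_morphism chain_class.
Proof. by move=> c d; rewrite /chain_class raddfB. Qed.

HB.instance Definition _ :=
  GRing.isZmodMorphism.Build _ _ chain_class chain_class_zmod_morphism.

Lemma chain_classP c d :
  chain_class c = chain_class d <-> exists e : chain R X 2, boundary e = c - d.
Proof.
rewrite /chain_class; split=> [/eqP|h]; last apply/eqP.
  by rewrite -Quotient.idealrBE => /asboolP.
by rewrite -Quotient.idealrBE; apply/asboolP.
Qed.

Lemma chain_class_boundary (e : chain R X 2) : chain_class (boundary e) = 0.
Proof. by rewrite -(raddf0 chain_class); apply/chain_classP; exists e; rewrite subr0. Qed.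

Definition cycle_class (z : cycle1 R X) : H1 R X := \pi_(H1 R X) z.

Lemma cycle_class_eq z z' :
  cycle_class z = cycle_class z' <-> chain_class (val z) = chain_class (val z').
Proof.
rewrite chain_classP /cycle_class; split=> [/eqP|h]; last apply/eqP.
  by rewrite -Quotient.idealrBE => /asboolP.
by rewrite -Quotient.idealrBE; apply/asboolP.
Qed.
End Chains.

(** * First homology of the height torus *)

Section TorusHomology.
Variables (R : realType) (E : ellipticCurve rat) (r : nat).
Variable B : 'I_r -> mordell_weil E.
Local Notation T := (height_torus R E).
Local Notation sing n := (continuousType (@simplex R n) T).
Local Notation V := 'rV[R]_r.

Fact torus_simplex_continuous n (g : @simplex R n -> V) :
  continuous g -> continuous (fun x => torus_point B (g x) : T).
Proof.
move=> cg x; apply: (@continuous_comp _ _ _ g (torus_point B : V -> T)).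
  exact: cg.
exact: torus_point_continuous.
Qed.

Definition torus_simplex n (g : @simplex R n -> V) (cg : continuous g) : sing n :=
  mkcts (torus_simplex_continuous cg).

Lemma torus_simplex_lift n (s : sing n) (g : @simplex R n -> V) (cg : continuous g) :
  is_lift B s g -> s = torus_simplex cg.
Proof. by move=> [_ gs]; apply/continuousEP => x; rewrite -gs. Qed.

Fact scaled_coord_continuous n i (a : V) :
  continuous (fun x : @simplex R n => val x 0 i *: a).
Proof.
apply: row_continuous => j.
have -> : (fun x : @simplex R n => (val x 0 i *: a) 0 j) =
    (fun x => val x 0 i * a 0 j).
  by apply/funext => x; rewrite mxE.
by apply: continuous_mul; [exact: simplex_coord_continuous|exact: cst_continuous].
Qed.

(** The first vertex of the 1-simplex is sent to a and the second one to 0: this is the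
orientation in which spokes occur as faces of the triangles of [cone_relation]. *)
Definition spoke (a : V) : chain R T 1 := << torus_simplex (@scaled_coord_continuous 1 0 a) >>.

(** The square (s, u) |-> (1 - u) g(s) has the path g at u = 0, the constant 0 at u = 1,
and the two spokes as its other sides. Cutting it along its diagonal gives two
singular triangles whose difference has, up to a constant simplex, the boundary
g - spoke(g(0)) + spoke(g(1)). The square avoids the singular apex of a cone. *)
Lemma cone_relation (g : @simplex R 1 -> V) (cg : continuous g) :
  chain_class (<< torus_simplex cg >> : chain R T 1) =
  chain_class (spoke (g (vertex R 0))) - chain_class (spoke (g (vertex R 1))).
Proof.
have c_scale n (u : @simplex R n -> R) (h : @simplex R n -> @simplex R 1) :
    continuous u -> continuous h -> continuous (fun x => u x *: g (h x)).
  move=> cu ch; apply: row_continuous => i.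
  have -> : (fun x => (u x *: g (h x)) 0 i) = (fun x => u x * g (h x) 0 i).
    by apply/funext => x; rewrite mxE.
  apply: continuous_mul => // x.
  apply: (@continuous_comp _ _ _ h (fun y => g y 0 i)); first exact: ch.
  apply: (@continuous_comp _ _ _ g (fun y : 'rV[R]_r => y 0 i)); first exact: cg.
  exact: coord_continuous.
have x2_01 (x : @simplex R 2) : 0 <= 1 - val x 0 2 <= 1.
  by have /andP[? ?] := simplex_le1 x 2; apply/andP; split; lra.
have cx2 : continuous (fun x : @simplex R 2 => 1 - val x 0 2).
  by apply: continuous_sub; [exact: cst_continuous|exact: simplex_coord_continuous].
have c1 : continuous (fun x : @simplex R 2 =>
    (1 - val x 0 2) *: g (edge_point (val x 0 0))).
  apply: c_scale => //; apply: edge_point_continuous => [x|].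
    exact: simplex_le1.
  exact: simplex_coord_continuous.
have c2 : continuous (fun x : @simplex R 2 =>
    val x 0 0 *: g (edge_point (1 - val x 0 2))).
  apply: c_scale; first exact: simplex_coord_continuous.
  exact: edge_point_continuous.
have cd : continuous (fun y : @simplex R 1 => val y 0 0 *: g y).
  by apply: (c_scale _ _ id); [exact: simplex_coord_continuous|move=> x].
have c0 n : continuous (fun _ : @simplex R n => 0 : V) by exact: cst_continuous.
have y0E (y : @simplex R 1) : 1 - val y 0 1 = val y 0 0.
  by rewrite -(simplex1_sum y) addrK.
(* With s = x1 + x2 and u = x2 on the first triangle, s = x2 and u = x1 + x2 on the
   second one; cd is the common diagonal u = s. *)
have D1 : boundary (<< torus_simplex c1 >> : chain R T 2) =
    spoke (g (vertex R 1)) - << torus_simplex cd >> + << torus_simplex cg >>.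
  rewrite boundary_triangle /spoke.
  congr (<< _ >> - << _ >> + << _ >>); apply/continuousEP => y;
    rewrite /= /mkcts /=; congr torus_point.
  - by have [-> ->] := face0_triangle y; rewrite y0E edge_point0.
  - by have [-> ->] := face1_triangle y; rewrite y0E edge_pointK.
  - by have [-> ->] := face2_triangle y; rewrite subr0 edge_pointK scale1r.
have D2 : boundary (<< torus_simplex c2 >> : chain R T 2) =
    << torus_simplex (c0 1%N) >> - << torus_simplex cd >> + spoke (g (vertex R 0)).
  rewrite boundary_triangle /spoke.
  congr (<< _ >> - << _ >> + << _ >>); apply/continuousEP => y;
    rewrite /= /mkcts /=; congr torus_point.
  - by have [-> ->] := face0_triangle y; rewrite scale0r.
  - by have [-> ->] := face1_triangle y; rewrite y0E edge_pointK.
  - by have [-> ->] := face2_triangle y; rewrite subr0 edge_point1.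
(* The three faces of a constant triangle coincide, so one of them survives. *)
have D0 : boundary (<< torus_simplex (c0 2%N) >> : chain R T 2) =
    << torus_simplex (c0 1%N) >>.
  rewrite boundary_triangle.
  have f0 i : (torus_simplex (c0 2%N) \o face i : sing 1) = torus_simplex (c0 1%N).
    by apply/continuousEP => y.
  by rewrite !f0 subrr add0r.
have h0 : chain_class (<< torus_simplex (c0 1%N) >> : chain R T 1) = 0.
  by rewrite -D0 chain_class_boundary.
have : chain_class (<< torus_simplex cd >> : chain R T 1) =
       chain_class (spoke (g (vertex R 0))).
  have := chain_class_boundary (<< torus_simplex c2 >> : chain R T 2).
  by rewrite D2 raddfD raddfB /= h0 sub0r addrC => /subr0_eq.
have := chain_class_boundary (<< torus_simplex c1 >> : chain R T 2).
rewrite D1 raddfD raddfB /= addrC => /eqP; rewrite addr_eq0 opprB => /eqP -> ->.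
by [].
Qed.

Variable hB : Zbasis B.

Lemma translate_continuous n (g : @simplex R n -> V) b :
  continuous g -> continuous (fun x => g x + b).
Proof.
move=> cg; apply: row_continuous => j.
have -> : (fun x => (g x + b) 0 j) = (fun x => g x 0 j + b 0 j).
  by apply/funext => x; rewrite mxE.
apply: continuous_add; last exact: cst_continuous.
move=> x; apply: (@continuous_comp _ _ _ g (fun y : V => y 0 j)); first exact: cg.
exact: coord_continuous.
Qed.

(** The cone relation for the segment from a + m to m, whose image in the torus is that
of the segment from a to 0. *)
Lemma spoke_translate (a : V) m : chain_class (spoke (a + int_row R m)) =
  chain_class (spoke a) + chain_class (spoke (int_row R m)).
Proof.
have := cone_relation (translate_continuous (b := int_row R m)
  (@scaled_coord_continuous 1 0 a)).
rewrite !mxE !eqxx /= scale1r scale0r add0r => /eqP.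
rewrite eq_sym subr_eq => /eqP ->; congr (chain_class << _ >> + _).
apply/continuousEP => y; apply/(torus_point_eq hB).
by exists m.
Qed.

Definition lattice_class (m : 'rV[int]_r) := chain_class (spoke (int_row R m)).

Lemma lattice_classD : {morph lattice_class : m n / m + n}.
Proof. by move=> m n; rewrite /lattice_class raddfD spoke_translate. Qed.

Fact lattice_class_zmod_morphism : zmod_morphism lattice_class.
Proof. by move=> m n; apply: (addIr (lattice_class n)); rewrite -lattice_classD !subrK. Qed.

HB.instance Definition _ :=
  GRing.isZmodMorphism.Build _ _ lattice_class lattice_class_zmod_morphism.

(** The cone relation for the segment from 0 to the coordinate vector of P. *)
Lemma geodesic_lattice_class P :
  chain_class (geodesic_chain R P) = - lattice_class (zcoord hB P).
Proof.
have := cone_relation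
  (@scaled_coord_continuous 1 1 (int_row R (zcoord hB P))).
rewrite !mxE !eqxx /= scale1r scale0r.
have -> : spoke 0 = spoke (int_row R 0) by rewrite raddf0.
rewrite -!/(lattice_class _) raddf0 sub0r => <-; congr (chain_class << _ >>).
apply/continuousEP => y; rewrite /= /geodesic_simplex (geodesicE hB).
by [].
Qed.

Definition geodesic_cycle (P : mordell_weil E) : cycle1 R T :=
  exist (fun c => is_cycle c) _ (geodesic_is_cycle R P).

Fact geodesic_class_zmod_morphism : zmod_morphism (@geodesic_class R E).
Proof.
move=> P Q; rewrite -![geodesic_class _ _]/(cycle_class (geodesic_cycle _)).
rewrite -[X in _ = X](raddfB (\pi_(H1 R T))); apply/cycle_class_eq.
have -> : val (geodesic_cycle P - geodesic_cycle Q) =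
    geodesic_chain R P - geodesic_chain R Q by exact: raddfB.
by rewrite raddfB /= !geodesic_lattice_class !raddfB.
Qed.

HB.instance Definition _ := GRing.isZmodMorphism.Build _ _ (@geodesic_class R E)
  geodesic_class_zmod_morphism.

(** Joining every point to the base point by the spoke of a chosen lift; composed with
the boundary it measures how far a chain is from being a cycle. *)
Definition spoke_chain (c : chain R T 0) : chain R T 1 :=
  fglift (fun s : sing 0 => - spoke (torus_coord B (s (vertex R 0))) : chain R T 1) c.

Fact spoke_chain_zmod_morphism : zmod_morphism spoke_chain.
Proof. exact: lift_is_additive. Qed.

HB.instance Definition _ :=
  GRing.isZmodMorphism.Build _ _ spoke_chain spoke_chain_zmod_morphism.

(** For a simplex with lift g, the cone relation gives spoke(g(0)) - spoke(g(1)). The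
endpoints of g differ from the chosen lifts of the endpoints of the simplex by
lattice vectors, whose spokes are geodesics. *)
Lemma chain_class_span (c : chain R T 1) : exists P,
  chain_class c = chain_class (spoke_chain (boundary c)) + chain_class (geodesic_chain R P).
Proof.
elim/chain_ind: c => [|u v [P uE] [Q vE]|s].
- by exists 0; rewrite geodesic_lattice_class !raddf0 addr0.
- exists (P - Q); rewrite raddfB /= uE vE !geodesic_lattice_class !raddfB /=.
  exact: addrACA.
have [g gs] := lift_exists hB (@cts_fun _ _ s).
have cg := gs.1.
have sE : chain_class (<< s >> : chain R T 1) =
    chain_class (spoke (g (vertex R 0))) - chain_class (spoke (g (vertex R 1))).
  by rewrite (torus_simplex_lift cg gs) cone_relation.
have end_spoke i : exists m, chain_class (spoke (g (vertex R i))) =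
    chain_class (spoke (torus_coord B (s (vertex R i)))) + lattice_class m.
  have /esym := torus_coordK hB (s (vertex R i)); rewrite -{1}gs.2.
  by move=> /(torus_point_eq hB)[m mE]; exists m; rewrite mE spoke_translate.
have [m mE] := end_spoke 0; have [m' mE'] := end_spoke 1.
exists (\sum_i B i *~ (m' - m) 0 i).
rewrite sE mE mE' geodesic_lattice_class (zcoord_unique hB (erefl _)).
have l0 : fintype.lift (0 : 'I_2) (0 : 'I_1) = 1 by apply: val_inj.
have l1 : fintype.lift (1 : 'I_2) (0 : 'I_1) = 0 by apply: val_inj.
rewrite boundary_edge /spoke_chain raddfB /= !liftU !scale1r /= !face_vertex l0 l1.
by rewrite opprK [- spoke _ + _]addrC !raddfB /= opprD addrACA opprK [- _ + lattice_class m]addrC.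
Qed.

Lemma H1_span (z : H1 R T) : exists P, z = geodesic_class R P.
Proof.
rewrite -[z]reprK; move: (repr z) => c {z}.
have [P PE] := chain_class_span (val c); exists P.
apply/(cycle_class_eq c (geodesic_cycle P)).
by rewrite PE (eqP (valP c)) raddf0 raddf0 add0r.
Qed.

(** Valued in the integer module on R^r, so that it extends linearly to integral
chains. *)
Definition displacement (s : sing 1) : zmodule V :=
  let g := projT1 (cid (lift_exists hB (@cts_fun _ _ s))) in
  g (vertex R 1) - g (vertex R 0).

Lemma displacementE (s : sing 1) g : is_lift B s g ->
  displacement s = g (vertex R 1) - g (vertex R 0).
Proof.
by move=> gs; rewrite /displacement; case: cid => g' g's; apply: lift_difference g's gs _ _.
Qed.

Definition total_displacement : chain R T 1 -> zmodule V := fglift displacement.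

HB.instance Definition _ := GRing.isZmodMorphism.Build _ _ total_displacement
  (lift_is_additive displacement).

Lemma total_displacement1 (s : sing 1) g : is_lift B s g ->
  total_displacement << s >> = g (vertex R 1) - g (vertex R 0).
Proof. by move=> gs; rewrite /total_displacement liftU scale1r (displacementE gs). Qed.

(** A lift of a triangle restricts to lifts of its faces, and the differences of the
vertices of the lift cancel around the triangle. *)
Lemma total_displacement_boundary e : total_displacement (boundary e) = 0.
Proof.
elim/chain_ind: e => [|u v uE vE|s].
- by rewrite !raddf0.
- by rewrite !raddfB /= uE vE subr0.
have [g gs] := lift_exists hB (@cts_fun _ _ s).
have lf i : is_lift B (s \o face i : sing 1) (g \o face i).
  split=> x; last by rewrite /= gs.2.
  by apply: continuous_comp; [exact: face_continuous|exact: gs.1].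
rewrite boundary_triangle raddfD raddfB /= !(total_displacement1 (lf _)) /=.
rewrite !face_vertex.
have -> : fintype.lift (0 : 'I_3) (1 : 'I_2) = fintype.lift 1 (1 : 'I_2) by apply: val_inj.
have -> : fintype.lift (0 : 'I_3) (0 : 'I_2) = fintype.lift 2 (1 : 'I_2) by apply: val_inj.
have -> : fintype.lift (1 : 'I_3) (0 : 'I_2) = fintype.lift 2 (0 : 'I_2) by apply: val_inj.
move: (g _) (g _) (g _) => a b c.
by rewrite opprB [_ + (a - c)]addrC !subrKA subrr.
Qed.

Lemma total_displacement_geodesic P :
  total_displacement (geodesic_chain R P) = int_row R (zcoord hB P).
Proof.
pose g (y : @simplex R 1) := val y 0 1 *: int_row R (zcoord hB P).
rewrite (@total_displacement1 _ g) /g.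
  by rewrite !mxE /= scale1r scale0r subr0.
split=> [|y]; last by rewrite /= /geodesic_simplex (geodesicE hB).
exact: scaled_coord_continuous.
Qed.

Lemma int_row_inj : injective (@int_row r R).
Proof. by move=> m n /rowP mn; apply/rowP => i; have := mn i; rewrite !mxE => /intr_inj. Qed.

Lemma geodesic_class_inj : injective (@geodesic_class R E).
Proof.
move=> P Q /(cycle_class_eq (geodesic_cycle P) (geodesic_cycle Q))/chain_classP[e eE].
have := total_displacement_boundary e; rewrite eE raddfB /=.
rewrite !total_displacement_geodesic => /subr0_eq/int_row_inj.
by rewrite {2}(zcoordE hB P) {2}(zcoordE hB Q) => ->.
Qed.

Lemma geodesic_class_comb (n : 'rV[int]_r) :
  geodesic_class R (\sum_i B i *~ n 0 i) = \sum_i geodesic_class R (B i) *~ n 0 i.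
Proof. by rewrite raddf_sum; apply: eq_bigr => i _; rewrite raddfMz. Qed.

Lemma geodesic_class_basis : Zbasis (fun i => geodesic_class R (B i)).
Proof.
split=> [z|n].
  have [P ->] := H1_span z; exists (zcoord hB P).
  by rewrite -geodesic_class_comb -zcoordE.
rewrite -geodesic_class_comb -(raddf0 (@geodesic_class R E)).
by move=> /geodesic_class_inj/hB.2.
Qed.
End TorusHomology.

(** * Winding vectors and change of basis *)

Section Winding.
Variables (R : realType) (E : ellipticCurve rat) (r : nat).
Variables (B : 'I_r -> mordell_weil E) (hB : Zbasis B) (rho : 'I_r -> R).

Lemma circles_turn (x : 'rV[R]_r) m : circles rho (x + int_row R m) = circles rho x.
Proof. by apply/rowP => k; rewrite !mxE /= !mxE; case: odd; rewrite (sin_turn, cos_turn). Qed.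

Lemma circles_inj (x y : 'rV[R]_r) : (forall i, 0 < rho i) ->
  circles rho x = circles rho y -> exists m, x = y + int_row R m.
Proof.
move=> rho0 xy.
have coordE (b : bool) i : (if b then sin else cos) (2 * pi * x 0 i) =
    (if b then sin else cos) (2 * pi * y 0 i).
  have k2r : (b + i.*2 < 2 * r)%N.
    by rewrite mul2n; case: b; rewrite ?ltn_Sdouble ?ltn_double //= ltn_ord.
  have /rowP/(_ (Ordinal k2r)) := xy; rewrite !mxE /=.
  have -> : Ordinal (half_ltn (Ordinal k2r)) = i by apply: val_inj; rewrite /= half_bit_double.
  rewrite oddD odd_double addbF oddb.
  by apply: mulfI; rewrite gt_eqF.
have turn i := eq_turn (coordE false i) (coordE true i).
exists (\row_i projT1 (cid (turn i))).
by apply/rowP => i; rewrite !mxE; case: cid.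
Qed.

Lemma toroidal_embeddingE (x : 'rV[R]_r) :
  toroidal_embedding B rho (torus_point B x) = circles rho x.
Proof.
have /(torus_point_eq hB)[m xE] := torus_coordK hB (torus_point B x : height_torus R E).
by rewrite /toroidal_embedding xE circles_turn.
Qed.

Lemma geodesic_winding (P : mordell_weil E) : winding_vector B rho (geodesic P) (zcoord hB P).
Proof.
move=> t _; rewrite (geodesicE hB) toroidal_embeddingE; congr circles.
by apply/rowP => i; rewrite !mxE mulrC.
Qed.

(** If d is a nonzero coordinate of the difference, the time t = 1 / (2 |d|) lies in
[0, 1] and t d = +-1/2 is not an integer. *)
Lemma winding_unique (P : mordell_weil E) n : (forall i, 0 < rho i) ->
  winding_vector B rho (geodesic P) n -> n = zcoord hB P.
Proof.
move=> rho0 nP; apply/rowP => i; apply/eqP; rewrite -subr_eq0; apply/negPn/negP => d0.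
set d := n 0 i - zcoord hB P 0 i in d0.
have d1 : 1 <= `|d|%:~R :> R by rewrite ler1z -gtz0_ge1 normr_gt0.
pose t : R := (2 * `|d|%:~R)^-1.
have t01 : 0 <= t <= 1.
  by rewrite invr_ge0 invf_le1 /=; first (apply/andP; split); lra.
have := nP t t01; rewrite geodesic_winding // => /(circles_inj rho0)[m] /rowP/(_ i).
rewrite !mxE => tE.
have mE : (m 0 i)%:~R = - (d%:~R * t) :> R by rewrite /d rmorphB /=; lra.
have : (2 * `|m 0 i|)%:~R = 1%:~R :> R.
  rewrite rmorphM /= intr_norm mE normrN normrM -intr_norm ger0_norm; last by case/andP: t01.
  by rewrite /t; field; rewrite gt_eqF //; lra.
by move/intr_inj; lia.
Qed.
End Winding.

Lemma basis_change (M : zmodType) r (B B' : 'I_r -> M) (hB : Zbasis B) (hB' : Zbasis B') x :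
  zcoord hB' x = zcoord hB x *m \matrix_(i, j) zcoord hB' (B i) 0 j.
Proof.
rewrite {1}(zcoordE hB x) raddf_sum; apply/rowP => j; rewrite summxE mxE.
by apply: eq_bigr => i _; rewrite raddfMz -scaler_int !mxE intz.
Qed.

Theorem proposition7p1 (R : realType) (E : ellipticCurve rat) (r : nat)
    (B : 'I_r -> mordell_weil E) (rho : 'I_r -> R)
    (hB : Zbasis B) (hrho : forall i, 0 < rho i) :
  [/\ (* J is given in the coordinates of B by the defining formula *)
      forall x : 'rV[R]_r,
        toroidal_embedding B rho (torus_point B x) = circles rho x,
      (* the image of the closed geodesic of P *)
      forall (P : mordell_weil E) (n : 'rV[int]_r),
        P = \sum_i B i *~ n 0 i ->
        forall t : R, 0 <= t <= 1 ->
          toroidal_embedding B rho (geodesic P t) =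
          circles rho (\row_i ((n 0 i)%:~R * t)),
      (* the winding vector is the coordinate vector of the homology class *)
      Zbasis (fun i => geodesic_class R (B i)) /\
      (forall (P : mordell_weil E) (n : 'rV[int]_r),
        winding_vector B rho (geodesic P) n ->
        geodesic_class R P = \sum_i geodesic_class R (B i) *~ n 0 i)
    & (* change of Mordell-Weil basis *)
      forall B' : 'I_r -> mordell_weil E, Zbasis B' ->
        exists U : 'M[int]_r,
          [/\ U \in unitmx,
              forall i, B i = \sum_j B' j *~ U i j
            & forall (P : mordell_weil E) (n n' : 'rV[int]_r),
                winding_vector B rho (geodesic P) n ->
                winding_vector B' rho (geodesic P) n' ->
                n' = n *m U]].
Proof.
split.
- exact: toroidal_embeddingE.
- by move=> P n /(zcoord_unique hB) <-; exact: geodesic_winding.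
- split=> [|P n /(winding_unique hB hrho) ->]; first exact: geodesic_class_basis.
  by rewrite -(geodesic_class_comb R hB) -zcoordE.
move=> B' hB'; exists (\matrix_(i, j) zcoord hB' (B i) 0 j); split.
- suff: \matrix_(i, j) zcoord hB' (B i) 0 j *m (\matrix_(i, j) zcoord hB (B' i) 0 j) = 1%:M.
    by move/mulmx1_unit => [].
  apply/row_matrixP => i; rewrite row_mul rowK row1 -(zcoord_basis hB).
  by rewrite (basis_change hB' hB); congr (_ *m _); apply/rowP => j; rewrite mxE.
- by move=> i; rewrite {1}(zcoordE hB' (B i)); apply: eq_bigr => j _; rewrite mxE.
- move=> P n n' /(winding_unique hB hrho) -> /(winding_unique hB' hrho) ->.
  exact: basis_change.
Qed.
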